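(* Let $f:\mathbb{R}^d\to\mathbb{R}$ and let $x^*$ be a local minimizer of the problem of minimizing $f(x)$ subject to $x\in\mathcal{F}$, where $\mathcal{F}$ is the feasible region of the system (S) described in the context and $f$ is Lipschitz continuous around $x^*$. Suppose that RCPLD holds at $x^*$. Then $x^*$ is an M-stationary point, i.e., there exist $\lambda_i^g\ge 0$ ($i\in I_g^*$), $\lambda_i^h\in\mathbb{R}$ ($i=1,\dots,m$), $\lambda_i^G\in\mathbb{R}$ and $\lambda_i^H\in\mathbb{R}$ ($i=1,\dots,p$) such that $$0\in\partial f(x^* )+\sum_{i\in I_g^*}\lambda_i^g\,\partial g_i(x^* )+\sum_{i=1}^m\lambda_i^h\nabla h_i(x^* )-\sum_{i\in\mathcal{I}^*\cup\mathcal{J}^*}\lambda_i^G\nabla G_i(x^* )-\sum_{i\in\mathcal{K}^*\cup\mathcal{J}^*}\lambda_i^H\nabla H_i(x^* )+\mathcal{N}_C(x^* ),$$ with $\lambda_i^H=0$ for $i\in\mathcal{I}^*$, $\lambda_i^G=0$ for $i\in\mathcal{K}^*$, and, for every $i\in\mathcal{J}^*$, either $\lambda_i^G>0$ and $\lambda_i^H>0$, or $\lambda_i^G\lambda_i^H=0$.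
   Context: Variational notions. For $C\subseteq\mathbb{R}^d$ and $z\in C$, the regular normal cone is $\widehat{\mathcal{N}}_C(z)=\{v:\langle v,z'-z\rangle\le o(\|z'-z\|)\ \text{for all } z'\in C\}$ and the limiting normal cone is $\mathcal{N}_C(z)=\{\lim v_k: v_k\in\widehat{\mathcal{N}}_C(z_k),\ z_k\in C,\ z_k\to z\}$ (empty if $z\notin C$). For a lower semicontinuous $f$ finite at $x$, $\widehat\partial f(x)=\{\zeta: f(x')-f(x)-\langle\zeta,x'-x\rangle\ge o(\|x'-x\|)\}$ and the limiting subdifferential is $\partial f(x)=\{\lim\xi_k:\xi_k\in\widehat\partial f(x_k),\ x_k\to x,\ f(x_k)\to f(x)\}$. System (S): $g_i(x)\le 0$ ($i=1,\dots,n$), $h_i(x)=0$ ($i=1,\dots,m$), $(G(x),H(x))\in\Omega^p$, $x\in C$, where $\Omega^p=\{(y,z)\in\mathbb{R}^p\times\mathbb{R}^p: 0\le y\perp z\ge 0\}$; $C=C_1\times\cdots\times C_l$ with $C_i\subseteq\mathbb{R}^{q_i}$ closed, $q_1+\cdots+q_l=d$ (points are written $x=(x_1,\dots,x_l)$ with $x_i\in\mathbb{R}^{q_i}$); $g_i:\mathbb{R}^d\to\mathbb{R}$ are locally Lipschitz, and $h_i:\mathbb{R}^d\to\mathbb{R}$, $G,H:\mathbb{R}^d\to\mathbb{R}^p$ are continuously differentiable around the feasible point $x^*$ considered. $\mathcal{F}$ is the set of solutions of (S). Index sets at $x^*\in\mathcal{F}$: $I_g^*=\{i:g_i(x^* )=0\}$,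 $\mathcal{I}^*=\{i:0=G_i(x^* )<H_i(x^* )\}$, $\mathcal{J}^*=\{i:G_i(x^* )=H_i(x^* )=0\}$, $\mathcal{K}^*=\{i:G_i(x^* )>H_i(x^* )=0\}$. RCPLD holds at $x^*\in\mathcal{F}$ if: (i) the vectors $\{\nabla h_i(x)\}_{i=1}^m\cup\{\nabla G_i(x)\}_{i\in\mathcal{I}^*}\cup\{\nabla H_i(x)\}_{i\in\mathcal{K}^*}$ have the same rank for all $x$ in a neighbourhood of $x^*$; (ii) let $\mathcal{I}_1\subseteq\{1,\dots,m\}$, $\mathcal{I}_2\subseteq\mathcal{I}^*$, $\mathcal{I}_3\subseteq\mathcal{K}^*$ be such that $\{\nabla h_i(x^* )\}_{i\in\mathcal{I}_1}\cup\{\nabla G_i(x^* )\}_{i\in\mathcal{I}_2}\cup\{\nabla H_i(x^* )\}_{i\in\mathcal{I}_3}$ is a basis of the span of the vectors in (i) at $x=x^*$. For any $\mathcal{I}_4\subseteq I_g^*$, $\mathcal{I}_5,\mathcal{I}_6\subseteq\mathcal{J}^*$: whenever there are $v_i^*\in\partial g_i(x^* )$ ($i\in\mathcal{I}_4$) and a nonzero vector $(\lambda^g,\lambda^h,\lambda^G,\lambda^H,\eta^* )\in\mathbb{R}^n\times\mathbb{R}^m\times\mathbb{R}^p\times\mathbb{R}^p\times\mathbb{R}^d$, whose components $\lambda_i^g,\lambda_i^h,\lambda_i^G,\lambda_i^H$ vanish for indices outside $\mathcal{I}_4,\ \mathcal{I}_1,\ \mathcal{I}_2\cup\mathcal{I}_5,\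 \mathcal{I}_3\cup\mathcal{I}_6$ respectively, with $\lambda_i^g\ge0$ for $i\in\mathcal{I}_4$, either $\lambda_i^G>0,\lambda_i^H>0$ or $\lambda_i^G\lambda_i^H=0$ for all $i\in\mathcal{J}^*$, $\eta^*=(\eta_1^*,\dots,\eta_l^* )\in\mathcal{N}_C(x^* )=\mathcal{N}_{C_1}(x_1^* )\times\cdots\times\mathcal{N}_{C_l}(x_l^* )$, and $$0=\sum_{i\in\mathcal{I}_4}\lambda_i^gv_i^*+\sum_{i\in\mathcal{I}_1}\lambda_i^h\nabla h_i(x^* )-\sum_{i\in\mathcal{I}_2\cup\mathcal{I}_5}\lambda_i^G\nabla G_i(x^* )-\sum_{i\in\mathcal{I}_3\cup\mathcal{I}_6}\lambda_i^H\nabla H_i(x^* )+\eta^*,$$ then for all sequences $x^k\to x^*$ with $x^k\ne x^*$, $v_i^k\in\partial g_i(x^k)$ with $v_i^k\to v_i^*$ ($i\in\mathcal{I}_4$), and $\eta^k=(\eta_1^k,\dots,\eta_l^k)\to\eta^*$ with $\eta_i^k\in\mathcal{N}_{C_i}(x_i^k)$ for all $i$, the vectors $$\{v_i^k\}_{i\in\mathcal{I}_4}\cup\{\nabla h_i(x^k)\}_{i\in\mathcal{I}_1}\cup\{\nabla G_i(x^k)\}_{i\in\mathcal{I}_2\cup\mathcal{I}_5}\cup\{\nabla H_i(x^k)\}_{i\in\mathcal{I}_3\cup\mathcal{I}_6}\cup\{\nu_i^k\}_{i\in L}$$ are linearly dependent for all sufficiently large $k$, where $\nu_i^k\in\mathbb{R}^d$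 has $i$-th block $\eta_i^k$ and all other blocks $0$, and $L=\{i\in\{1,\dots,l\}:\eta_i^k\ne0\}$. Collections of vectors are treated as indexed families when speaking of rank and linear (in)dependence. *)

(* Defs.v *)
From mathcomp Require Export all_boot all_order all_algebra.
From mathcomp Require Export all_classical all_reals all_analysis.

Set Implicit Arguments.
Unset Strict Implicit.
Unset Printing Implicit Defensive.

Import Order.TTheory GRing.Theory Num.Theory.
Import numFieldNormedType.Exports.

Local Open Scope classical_set_scope.
Local Open Scope ring_scope.

(* Points of R^N are row vectors.  The norm `|x| on 'rV[R]_N is the sup norm;
   it is used only in little-o conditions, Lipschitz conditions and limits,
   which do not depend on the choice of a norm on R^N. *)

Section Variational.
Variables (R : realType) (N : nat).
Implicit Types (x z u v zeta : 'rV[R]_N) (f : 'rV[R]_N -> R) (C : set 'rV[R]_N).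

Definition dot u v : R := \sum_(j < N) u 0 j * v 0 j.

Definition gradient f x : 'rV[R]_N := \row_j 'D_(delta_mx 0 j) f x.

Definition C1_around f x : Prop :=
  \forall y \near x, differentiable f y /\ {for y, continuous (gradient f)}.

Definition lipschitz_around f x : Prop :=
  exists2 U : set 'rV[R]_N, nbhs x U & [lipschitz f y | y in U].

Definition regular_normal_cone C z : set 'rV[R]_N :=
  [set v | C z /\ forall eps : R, 0 < eps ->
     \forall z' \near z, C z' -> dot v (z' - z) <= eps * `|z' - z|].

Definition limiting_normal_cone C z : set 'rV[R]_N :=
  [set v | C z /\ exists (z_ v_ : nat -> 'rV[R]_N),
     [/\ forall k, C (z_ k) /\ regular_normal_cone C (z_ k) (v_ k),
         z_ @ \oo --> z & v_ @ \oo --> v]].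

Definition regular_subdifferential f x : set 'rV[R]_N :=
  [set zeta | forall eps : R, 0 < eps ->
     \forall x' \near x, - (eps * `|x' - x|) <= f x' - f x - dot zeta (x' - x)].

Definition limiting_subdifferential f x : set 'rV[R]_N :=
  [set zeta | exists (x_ zeta_ : nat -> 'rV[R]_N),
     [/\ forall k, regular_subdifferential f (x_ k) (zeta_ k),
         x_ @ \oo --> x, f (x_ k) @[k --> \oo] --> f x
       & zeta_ @ \oo --> zeta]].

Definition local_minimizer f (F : set 'rV[R]_N) x : Prop :=
  F x /\ \forall y \near x, F y -> f x <= f y.

End Variational.

Definition complementarity_set (R : realType) (p : nat) :
    set ('rV[R]_p * 'rV[R]_p) :=
  [set yz : 'rV[R]_p * 'rV[R]_p | [/\ forall i, 0 <= yz.1 0 i, dot yz.1 yz.2 = 0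
              & forall i, 0 <= yz.2 0 i]].

(* The data of the system; R^d is R^(q_1) x ... x R^(q_l), encoded by
   d = \sum_i q i, and the i-th block of x : 'rV_d is submxrow x i. *)
Record csystem (R : realType) (n m p l : nat) (q : 'I_l -> nat) := CSystem {
  sys_g : 'I_n -> 'rV[R]_(\sum_i q i) -> R;
  sys_h : 'I_m -> 'rV[R]_(\sum_i q i) -> R;
  sys_G : 'rV[R]_(\sum_i q i) -> 'rV[R]_p;
  sys_H : 'rV[R]_(\sum_i q i) -> 'rV[R]_p;
  sys_C : forall i : 'I_l, set 'rV[R]_(q i) }.
Arguments sys_C {R n m p l q} _ i _.

Section System.
Variables (R : realType) (n m p l : nat) (q : 'I_l -> nat).
Variable S : csystem R n m p q.
Local Notation Rd := 'rV[R]_(\sum_i q i).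
Implicit Types x : Rd.

Definition sys_Gi (i : 'I_p) x : R := sys_G S x 0 i.
Definition sys_Hi (i : 'I_p) x : R := sys_H S x 0 i.

Definition prodC : set Rd := [set x : Rd | forall i, sys_C S i (submxrow x i)].

Definition feasible : set Rd :=
  [set x | [/\ forall i, sys_g S i x <= 0, forall i, sys_h S i x = 0,
               complementarity_set (sys_G S x, sys_H S x) & prodC x]].

Definition standing_assumptions x : Prop :=
  [/\ forall i, closed (sys_C S i),
      forall i, lipschitz_around (sys_g S i) x,
      forall i, C1_around (sys_h S i) x,
      forall i, C1_around (sys_Gi i) x
    & forall i, C1_around (sys_Hi i) x].

Definition activeg x : {set 'I_n} := [set i | sys_g S i x == 0]%SET.
Definition idxI x : {set 'I_p} :=
  [set i | (sys_Gi i x == 0) && (0 < sys_Hi i x)]%SET.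
Definition idxJ x : {set 'I_p} :=
  [set i | (sys_Gi i x == 0) && (sys_Hi i x == 0)]%SET.
Definition idxK x : {set 'I_p} :=
  [set i | (0 < sys_Gi i x) && (sys_Hi i x == 0)]%SET.

(* Indexed families of vectors are represented by sequences: rank is the
   dimension of the span, and linear independence is vector.v's [free], which
   takes repetitions into account. *)
Definition smooth_family (I1 : {set 'I_m}) (I2 I3 : {set 'I_p}) x : seq Rd :=
  [seq gradient (sys_h S i) x | i in I1] ++
  [seq gradient (sys_Gi i) x | i in I2] ++
  [seq gradient (sys_Hi i) x | i in I3].

Definition only_block (eta : Rd) (i : 'I_l) : Rd :=
  \mxrow_j (if j == i then submxrow eta j else 0).

Definition nonzero_blocks (eta : Rd) : {set 'I_l} :=
  [set i | submxrow eta i != 0]%SET.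

Definition M_sign (lG lH : 'rV[R]_p) (i : 'I_p) : Prop :=
  (0 < lG 0 i /\ 0 < lH 0 i) \/ lG 0 i * lH 0 i = 0.

Definition RCPLD_multiplier x (I1 : {set 'I_m}) (I2 I3 : {set 'I_p})
    (I4 : {set 'I_n}) (I5 I6 : {set 'I_p}) (v : 'I_n -> Rd)
    (lg : 'rV[R]_n) (lh : 'rV[R]_m) (lG lH : 'rV[R]_p) (eta : Rd) : Prop :=
  [/\ ~ [/\ lg = 0, lh = 0, lG = 0, lH = 0 & eta = 0],
      [/\ forall i, i \notin I4 -> lg 0 i = 0,
          forall i, i \notin I1 -> lh 0 i = 0,
          forall i, i \notin I2 :|: I5 -> lG 0 i = 0
        & forall i, i \notin I3 :|: I6 -> lH 0 i = 0],
      (forall i, i \in I4 -> 0 <= lg 0 i) /\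
      (forall i, i \in idxJ x -> M_sign lG lH i),
      limiting_normal_cone prodC x eta
    & 0 = \sum_(i in I4) lg 0 i *: v i
          + \sum_(i in I1) lh 0 i *: gradient (sys_h S i) x
          - \sum_(i in I2 :|: I5) lG 0 i *: gradient (sys_Gi i) x
          - \sum_(i in I3 :|: I6) lH 0 i *: gradient (sys_Hi i) x
          + eta].

Definition RCPLD x : Prop :=
  (\forall y \near x,
     \dim <<smooth_family [set: 'I_m]%SET (idxI x) (idxK x) y>> =
     \dim <<smooth_family [set: 'I_m]%SET (idxI x) (idxK x) x>>)
  /\
  forall (I1 : {set 'I_m}) (I2 I3 : {set 'I_p}),
    I2 \subset idxI x -> I3 \subset idxK x ->
    basis_of <<smooth_family [set: 'I_m]%SET (idxI x) (idxK x) x>>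
             (smooth_family I1 I2 I3 x) ->
  forall (I4 : {set 'I_n}) (I5 I6 : {set 'I_p}),
    I4 \subset activeg x -> I5 \subset idxJ x -> I6 \subset idxJ x ->
  forall (v : 'I_n -> Rd) (lg : 'rV[R]_n) (lh : 'rV[R]_m) (lG lH : 'rV[R]_p)
         (eta : Rd),
    (forall i, i \in I4 -> limiting_subdifferential (sys_g S i) x (v i)) ->
    RCPLD_multiplier x I1 I2 I3 I4 I5 I6 v lg lh lG lH eta ->
  forall (x_ : nat -> Rd) (v_ : nat -> 'I_n -> Rd) (eta_ : nat -> Rd),
    x_ @ \oo --> x -> (forall k, x_ k != x) ->
    (forall i, i \in I4 ->
       (forall k, limiting_subdifferential (sys_g S i) (x_ k) (v_ k i)) /\
       v_ k i @[k --> \oo] --> v i) ->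
    eta_ @ \oo --> eta ->
    (forall k i, limiting_normal_cone (sys_C S i) (submxrow (x_ k) i)
                                      (submxrow (eta_ k) i)) ->
  \forall k \near \oo,
    ~~ free ([seq v_ k i | i in I4] ++
             smooth_family I1 (I2 :|: I5) (I3 :|: I6) (x_ k) ++
             [seq only_block (eta_ k) i | i in nonzero_blocks (eta_ k)]).

Definition M_stationary (f : Rd -> R) x : Prop :=
  exists (lg : 'rV[R]_n) (lh : 'rV[R]_m) (lG lH : 'rV[R]_p),
  [/\ forall i, i \in activeg x -> 0 <= lg 0 i,
      exists (zeta : Rd) (v : 'I_n -> Rd) (eta : Rd),
      [/\ limiting_subdifferential f x zeta,
          forall i, i \in activeg x ->
            limiting_subdifferential (sys_g S i) x (v i),
          limiting_normal_cone prodC x eta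
        & 0 = zeta + \sum_(i in activeg x) lg 0 i *: v i
              + \sum_(i < m) lh 0 i *: gradient (sys_h S i) x
              - \sum_(i in idxI x :|: idxJ x)
                  lG 0 i *: gradient (sys_Gi i) x
              - \sum_(i in idxK x :|: idxJ x)
                  lH 0 i *: gradient (sys_Hi i) x
              + eta],
      forall i, i \in idxI x -> lH 0 i = 0,
      forall i, i \in idxK x -> lG 0 i = 0
    & forall i, i \in idxJ x -> M_sign lG lH i].

End System.

(* Main.v *)
(** Penalizing the constraints quadratically (the complementarity system through its
    squared distance) yields global minimizers x_k -> x* on a ball intersected with C.
    At x_k the penalty has a majorant touching it there: choose the branch of each
    complementarity term that attains the minimum.  The limiting sum rule applied to
    this majorant gives approximate multipliers with the M-sign pattern.  The sum rule
    itself comes from decoupling: minimize sum_i phi_i(y_i) + j sum_i |y_i - z|^2 +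
    |z - x|^2 and let j go to infinity.

    By (i) of RCPLD the gradients of the equality-type constraints near x* are
    combinations of a fixed subfamily that is a basis at x*; a Caratheodory reduction,
    in which the blocks of the normal vector take part as vectors of their own, makes the
    vectors carrying nonzero multipliers linearly independent without changing signs.
    If the reduced multipliers stay bounded, their limit is an M-stationary multiplier.
    Otherwise, normalized, they converge to a nonzero vector as in (ii) of RCPLD, which
    forces linear dependence.  Nonzero multipliers also give x_k <> x*, since all
    residuals vanish at the feasible point x*.  Subsequences are replaced by limits
    along an ultrafilter on nat. *)

Require Import Defs.
From mathcomp Require Import ring lra.

Set Implicit Arguments.
Unset Strict Implicit.
Unset Printing Implicit Defensive.

Import Order.TTheory GRing.Theory Num.Theory.
Import numFieldNormedType.Exports.

Local Open Scope classical_set_scope.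
Local Open Scope ring_scope.

(** * Row vectors and limits along ultrafilters *)

(** Condition (ii) of RCPLD compares subgradients and normals taken at one common point [x_k]. The
    multiplier rule must therefore be exact in its base point: a fuzzy rule, whose subgradients live
    at different nearby points, would not feed it. This is why a limiting sum rule is applied at
    each penalized minimizer. All second-order remainders are absorbed in a term [e * |y - x|],
    whose subgradients have norm at most [e].

    The reduction may change the coefficients on the equality-type basis arbitrarily, because their
    signs are free. Every index where a sign matters (active [g], biactive pairs, blocks of the
    normal) lies outside the protected basis, and there a coefficient keeps its sign or vanishes. A
    block of a normal may be given its own nonnegative factor because the regular normal cone of a
    product splits. The M-sign pattern survives positive scaling, the reduction, and limits: it
    describes a closed set, a closed quadrant together with the two axes. *)

Lemma cvg_sumr (R : realType) (V : normedModType R) (T : Type)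
  (F : set_system T) {FF : Filter F} (I : finType) (P : pred I)
  (f : I -> T -> V) (l : I -> V) :
  (forall i, P i -> f i @ F --> l i) ->
  \sum_(i | P i) f i t @[t --> F] --> \sum_(i | P i) l i.
Proof. by move=> fl; apply: cvg_big => //; exact: add_continuous. Qed.

Section RowVectors.
Variables (R : realType) (d : nat).
Implicit Types (x y z u v w : 'rV[R]_d).

Lemma rV_norm_coord x j : `|x 0 j| <= `|x|.
Proof.
rewrite [`|x|]mx_normrE.
by apply: (le_bigmax _ (fun ij : 'I_1 * 'I_d => `|x ij.1 ij.2|) (0, j)).
Qed.

Lemma rV_norm_le x M : 0 <= M -> (forall j, `|x 0 j| <= M) -> `|x| <= M.
Proof.
move=> M0 xM; rewrite [`|x|]mx_normrE.
by apply/bigmax_leP; split => // -[i j] _ /=; rewrite ord1.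
Qed.

Lemma dotC u v : dot u v = dot v u.
Proof. by apply: eq_bigr => j _; rewrite mulrC. Qed.

Lemma dotDr w u v : dot w (u + v) = dot w u + dot w v.
Proof. by rewrite /dot -big_split; apply: eq_bigr => j _; rewrite !mxE mulrDr. Qed.

Lemma dotZr w a u : dot w (a *: u) = a * dot w u.
Proof. by rewrite /dot mulr_sumr; apply: eq_bigr => j _; rewrite !mxE mulrCA. Qed.

Lemma dotNr w u : dot w (- u) = - dot w u.
Proof. by rewrite -scaleN1r dotZr mulN1r. Qed.

Lemma dotBr w u v : dot w (u - v) = dot w u - dot w v.
Proof. by rewrite dotDr dotNr. Qed.

Lemma dotDl w u v : dot (u + v) w = dot u w + dot v w.
Proof. by rewrite !(dotC _ w) dotDr. Qed.

Lemma dotZl w a u : dot (a *: u) w = a * dot u w.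
Proof. by rewrite !(dotC _ w) dotZr. Qed.

Lemma dotNl w u : dot (- u) w = - dot u w.
Proof. by rewrite !(dotC _ w) dotNr. Qed.

Lemma dotBl w u v : dot (u - v) w = dot u w - dot v w.
Proof. by rewrite !(dotC _ w) dotBr. Qed.

Lemma dot_suml (I : finType) (F : I -> 'rV[R]_d) w :
  dot (\sum_i F i) w = \sum_i dot (F i) w.
Proof.
rewrite /dot exchange_big; apply: eq_bigr => j _ /=.
by rewrite summxE mulr_suml.
Qed.

Lemma dot_norm_le u v : `|dot u v| <= d%:R * (`|u| * `|v|).
Proof.
apply: (le_trans (ler_norm_sum _ _ _)).
have -> : d%:R * (`|u| * `|v|) = \sum_(j < d) `|u| * `|v|.
  by rewrite sumr_const card_ord mulr_natl.
by apply: ler_sum => j _; rewrite normrM ler_pM ?rV_norm_coord.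
Qed.

Lemma dot_ge0 u : 0 <= dot u u.
Proof. by apply: sumr_ge0 => j _; rewrite -expr2 sqr_ge0. Qed.

(** The sup norm is at most the Euclidean one, so quadratic penalties written with [dot] control the
    norm used in limits. *)
Lemma sqr_norm_le_dot u : `|u| ^+ 2 <= dot u u.
Proof.
rewrite -ler_sqrt ?dot_ge0// sqrtr_sqr normr_id.
apply: rV_norm_le => [|j]; first exact: sqrtr_ge0.
rewrite -sqrtr_sqr ler_sqrt ?dot_ge0// /dot (bigD1 j) //= -expr2 lerDl.
by apply: sumr_ge0 => i _; rewrite -expr2 sqr_ge0.
Qed.

Lemma dot_delta u j : dot u (delta_mx 0 j) = u 0 j.
Proof.
rewrite /dot (bigD1 j) //= mxE !eqxx mulr1 big1 ?addr0// => i ij.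
by rewrite mxE eqxx (negPf ij) mulr0.
Qed.

Lemma delta_norm_le1 (j : 'I_d) : `|delta_mx 0 j : 'rV[R]_d| <= 1.
Proof.
apply: rV_norm_le => // i; rewrite mxE eqxx /=.
by case: eqP => _; rewrite ?normr1 ?normr0.
Qed.

Lemma cvg_dot (T : Type) (F : set_system T) {FF : Filter F}
  (a b : T -> 'rV[R]_d) u v :
  a @ F --> u -> b @ F --> v -> dot (a t) (b t) @[t --> F] --> dot u v.
Proof.
move=> au bv; apply: cvg_sumr => j _.
have coord (c : T -> 'rV[R]_d) w : c @ F --> w -> c t 0 j @[t --> F] --> w 0 j.
  move=> cw; apply: (@cvg_comp _ _ _ c (fun M : 'rV[R]_d => M 0 j) F (nbhs w)) => //.
  exact: coord_continuous.
exact: cvgM (coord _ _ au) (coord _ _ bv).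
Qed.

Lemma box_compact x r : compact [set y : 'rV[R]_d | `|y - x| <= r].
Proof.
have -> : [set y : 'rV[R]_d | `|y - x| <= r] = closed_ball_ Num.norm x r.
  by apply/seteqP; split => y /=; rewrite distrC.
apply: bounded_closed_compact; last exact: closed_closed_ball_.
exists (`|x| + r); split; rewrite ?num_real// => M Mr y /= yr.
rewrite (le_trans _ (ltW Mr))// -[y](subrK x) addrC.
by rewrite (le_trans (ler_normD _ _))// lerD2l distrC.
Qed.

Lemma near_norm x (P : set 'rV[R]_d) :
  (\forall y \near x, P y) <->
  exists2 e, 0 < e & forall y, `|y - x| < e -> P y.
Proof.
split=> [/nbhs_normP[e /= e0 eP]|[e e0 eP]].
  by exists e => // y yx; apply: eP; rewrite /= distrC.
by apply/nbhs_normP; exists e => //= y /=; rewrite distrC => /eP.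
Qed.

End RowVectors.

Section Ultra.
Variables (R : realType) (d : nat).

Lemma ultra_nat : exists U : set_system nat,
  UltraFilter U /\ \oo `<=` U.
Proof. exact: ultraFilterLemma. Qed.

Lemma ultra_bounded_cvg (U : set_system nat) (UU : UltraFilter U)
  (u : nat -> 'rV[R]_d) M :
  (\forall k \near U, `|u k| <= M) -> exists l : 'rV[R]_d, u @ U --> l.
Proof.
move=> uM.
have /= := @box_compact R d 0 M; rewrite compact_ultra => /(_ (u @ U)).
(* The image filter is again maximal: a larger filter containing a set whose preimage is not in [U]
   would also contain the complement of that set. *)
have UF : UltraFilter (u @ U).
  split; first exact: fmap_proper_filter.
  move=> G GG uG; apply/seteqP; split => // A GA.
  have [//|nA] := in_ultra_setVsetC (u @^-1` A) UU.
  have : (~` A) `&` A !=set0.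
    exact: filter_ex (filterI (uG (~` A) nA) GA).
  by case=> ? [].
case=> [|l [_ ul]]; last by exists l.
by apply: (filterS _ uM) => k; rewrite /= subr0.
Qed.

End Ultra.

(** * Limiting subdifferentials and normal cones *)

Lemma inv_succ_lt (R : realType) (e : R) : 0 < e -> exists k : nat, k.+1%:R^-1 < e.
Proof.
move=> e0; exists (Num.truncn e^-1).
by rewrite invf_plt ?posrE// truncnS_gt.
Qed.

Lemma cvg_inv_succ (R : realType) (V : normedModType R) (u : nat -> V) l :
  (forall k, `|u k - l| < k.+1%:R^-1) -> u @ \oo --> l.
Proof.
move=> ul; apply/cvgrPdist_lt => e e0; have [K Ke] := inv_succ_lt e0.
exists K => // k /= Kk; rewrite distrC (lt_trans (ul k))// (le_lt_trans _ Ke)//.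
by rewrite lef_pV2 ?posrE// ler_nat.
Qed.

Lemma cvg_near_dist (R : realType) (V : normedModType R) (T : Type)
  (F : set_system T) {FF : Filter F} (u : T -> V) (l : V) (e : R) :
  u @ F --> l -> 0 < e -> \forall t \near F, `|u t - l| < e.
Proof.
move=> /cvgrPdist_lt ul e0; apply: filterS (ul e e0) => t.
by rewrite distrC.
Qed.

Definition lip_near (R : realType) (d : nat) (f : 'rV[R]_d -> R) x (L : R) :=
  exists2 e, 0 < e & forall y z, `|y - x| < e -> `|z - x| < e ->
    `|f y - f z| <= L * `|y - z|.

Section LimitingObjects.
Variables (R : realType) (d : nat).
Implicit Types (f g : 'rV[R]_d -> R) (x y z c zeta v : 'rV[R]_d) (C : set 'rV[R]_d).

Lemma lipschitz_around_near f x :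
  lipschitz_around f x -> exists2 L, 0 <= L & lip_near f x L.
Proof.
case=> U /near_norm[e e0 eU]; rewrite /lipschitz_on /= => fU.
have [L [L0 fL]] := filter_ex (filterI (nbhs_pinfty_gt (num_real (0 : R))) fU).
exists L; [exact: ltW|exists e => // y z ye ze].
by apply: (fL (y, z)); split; exact: eU.
Qed.

Lemma lip_near_shift f x L : lip_near f x L ->
  exists2 e, 0 < e & forall y, `|y - x| < e -> lip_near f y L.
Proof.
case=> e e0 fe; exists (e / 2) => [|y ye]; first exact: divr_gt0.
have aux z : `|z - y| < e / 2 -> `|z - x| < e.
  move=> ze; rewrite -(subrKA y) (le_lt_trans (ler_normD _ _))//.
  by rewrite [ltRHS]splitr ltrD.
by exists (e / 2) => [|z w /aux ? /aux ?]; [exact: divr_gt0|exact: fe].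
Qed.

Lemma lip_near_continuous f x L : lip_near f x L -> {for x, continuous f}.
Proof.
case=> e e0 fe; apply/(@cvgrPdist_lt _ _ _ (nbhs x)) => t t0; apply/near_norm.
exists (Num.min e (t / (`|L| + 1))) => [|y].
  by rewrite lt_min e0 divr_gt0// ltr_wpDl.
rewrite lt_min => /andP[ye yt].
rewrite (le_lt_trans (fe _ _ _ ye)) ?subrr ?normr0//.
apply: (@le_lt_trans _ _ ((`|L| + 1) * `|x - y|)).
  by rewrite ler_wpM2r// (le_trans (ler_norm _))// lerDl.
by rewrite distrC mulrC -ltr_pdivlMr// ltr_wpDl.
Qed.

(** Trades the sequences of the definition for a tolerance, so that diagonal arguments become two
    halves of [e] instead of a reindexing. *)
Lemma limiting_subdifferential_approxP f x zeta :
  limiting_subdifferential f x zeta <->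
  forall e : R, 0 < e -> exists x' zeta',
    [/\ `|x' - x| < e, `|f x' - f x| < e, `|zeta' - zeta| < e
      & regular_subdifferential f x' zeta'].
Proof.
split=> [[x_ [z_ [reg xx fx zz]]] e e0|].
  have [k [[xk fk] zk]] := filter_ex (filterI (filterI (cvg_near_dist xx e0)
    (cvg_near_dist fx e0)) (cvg_near_dist zz e0)).
  by exists (x_ k), (z_ k); split.
move=> H; have /choice[u uP] : forall k, exists u : 'rV[R]_d * 'rV[R]_d,
    [/\ `|u.1 - x| < k.+1%:R^-1, `|f u.1 - f x| < k.+1%:R^-1,
        `|u.2 - zeta| < k.+1%:R^-1 & regular_subdifferential f u.1 u.2].
  move=> k; have [|x' [z' ?]] := H k.+1%:R^-1; first by rewrite invr_gt0.
  by exists (x', z').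
exists (fun k => (u k).1), (fun k => (u k).2); split.
- by move=> k; have [] := uP k.
- by apply: cvg_inv_succ => k; have [] := uP k.
- by apply: cvg_inv_succ => k; have [] := uP k.
- by apply: cvg_inv_succ => k; have [] := uP k.
Qed.

Lemma limiting_normal_cone_approxP C x v :
  limiting_normal_cone C x v <->
  C x /\ forall e : R, 0 < e -> exists x' v',
    [/\ `|x' - x| < e, `|v' - v| < e & regular_normal_cone C x' v'].
Proof.
split=> [[Cx [x_ [v_ [reg xx vv]]]]|].
  split=> // e e0; have [k [xk vk]] := filter_ex (filterI (cvg_near_dist xx e0)
    (cvg_near_dist vv e0)).
  by exists (x_ k), (v_ k); split => //; have [] := reg k.
move=> [Cx H]; split=> //.
have /choice[u uP] : forall k, exists u : 'rV[R]_d * 'rV[R]_d,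
    [/\ `|u.1 - x| < k.+1%:R^-1, `|u.2 - v| < k.+1%:R^-1
      & regular_normal_cone C u.1 u.2].
  move=> k; have [|x' [v' ?]] := H k.+1%:R^-1; first by rewrite invr_gt0.
  by exists (x', v').
exists (fun k => (u k).1), (fun k => (u k).2); split.
- by move=> k; have [_ _ reg] := uP k; split=> //; case: reg.
- by apply: cvg_inv_succ => k; have [] := uP k.
- by apply: cvg_inv_succ => k; have [] := uP k.
Qed.

(** Continuity at [x] supplies the convergence of values that the definition demands and the
    hypothesis does not mention. *)
Lemma limiting_subdifferential_closed f x zeta :
  {for x, continuous f} ->
  (forall e : R, 0 < e -> exists x' zeta',
    [/\ `|x' - x| < e, `|zeta' - zeta| < e
      & limiting_subdifferential f x' zeta']) ->
  limiting_subdifferential f x zeta.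
Proof.
move=> fx H; apply/limiting_subdifferential_approxP => e e0.
have e20 : 0 < e / 2 by rewrite divr_gt0.
have /near_norm[t t0 ft] : \forall y \near x, `|f y - f x| < e / 2.
  exact: cvg_near_dist fx e20.
have [|x' [z' [x'x z'z]]] := H (Num.min (e / 2) t).
  by rewrite lt_min e20.
move: x'x z'z; rewrite !lt_min => /andP[x'e x't] /andP[z'e _].
move=> /limiting_subdifferential_approxP/(_ _ e20)[y [w [yx fy wz reg]]].
exists y, w; split => //.
- by rewrite -(subrKA x') (le_lt_trans (ler_normD _ _))// [ltRHS]splitr ltrD.
- rewrite -(subrKA (f x')) (le_lt_trans (ler_normD _ _))// [ltRHS]splitr ltrD//.
  exact: ft.
- by rewrite -(subrKA z') (le_lt_trans (ler_normD _ _))// [ltRHS]splitr ltrD.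
Qed.

Lemma limiting_normal_cone_closed C x v : C x ->
  (forall e : R, 0 < e -> exists x' v',
    [/\ `|x' - x| < e, `|v' - v| < e & limiting_normal_cone C x' v']) ->
  limiting_normal_cone C x v.
Proof.
move=> Cx H; apply/limiting_normal_cone_approxP; split => // e e0.
have e20 : 0 < e / 2 by rewrite divr_gt0.
have [x' [v' [x'x v'v]]] := H _ e20.
move=> /limiting_normal_cone_approxP[_ /(_ _ e20)[y [w [yx wv reg]]]].
exists y, w; split => //.
- by rewrite -(subrKA x') (le_lt_trans (ler_normD _ _))// [ltRHS]splitr ltrD.
- by rewrite -(subrKA v') (le_lt_trans (ler_normD _ _))// [ltRHS]splitr ltrD.
Qed.

(** Stepping from [x] along each coordinate, with the sign of that entry of [zeta - c], bounds the
    sup norm. The slope [c] lets one statement cover Lipschitz functions ([c = 0]) and a linear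
    function plus a small cone [e * |y - x|]. *)
Lemma regular_subdifferential_bound f x c zeta L : 0 <= L ->
  lip_near (fun y => f y - dot c y) x L ->
  regular_subdifferential f x zeta -> `|zeta - c| <= L.
Proof.
move=> L0 [e e0 fL] reg; apply/ler_addgt0Pr => t t0.
apply: rV_norm_le => [|j]; first by rewrite addr_ge0// ltW.
have /near_norm[s s0 regs] := reg t t0.
pose r := Num.min e s / 2.
have r0 : 0 < r by rewrite divr_gt0// lt_min e0.
have rlt : r < Num.min e s.
  by rewrite /r ltr_pdivrMr// mulr_natr mulr2n ltrDl lt_min e0.
pose h := (r * Num.sg ((zeta - c) 0 j)) *: (delta_mx 0 j : 'rV[R]_d).
have hr : `|h| <= r.
  rewrite normrZ normrM (gtr0_norm r0) normr_sg -mulrA ler_piMr ?(ltW r0)//.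
  by rewrite mulr_ile1// ?delta_norm_le1//; case: (_ != 0).
have hlt := le_lt_trans hr rlt.
rewrite lt_min in hlt; case/andP: hlt => he hs.
have := regs (h + x); rewrite addrK => /(_ hs).
have := fL (h + x) x; rewrite addrK subrr normr0 => /(_ he e0).
rewrite ler_norml => /andP[_]; rewrite !dotDr.
have : dot (zeta - c) h = r * `|(zeta - c) 0 j|.
  by rewrite /h dotZr dot_delta -mulrA -normrEsg.
rewrite dotBl => dotE flip freg.
have : r * `|(zeta - c) 0 j| <= r * (L + t).
  have : L * `|h| + t * `|h| <= (L + t) * r.
    by rewrite -mulrDl ler_wpM2l// addr_ge0// ltW.
  lra.
by rewrite ler_pM2l.
Qed.

Lemma limiting_subdifferential_bound f x c zeta L : 0 <= L ->
  lip_near (fun y => f y - dot c y) x L ->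
  limiting_subdifferential f x zeta -> `|zeta - c| <= L.
Proof.
move=> L0 /lip_near_shift[e e0 fL] /limiting_subdifferential_approxP lim.
apply/ler_addgt0Pr => t t0.
have [|y [w [yx _ wz reg]]] := lim (Num.min e t); first by rewrite lt_min e0.
move: yx wz; rewrite !lt_min => /andP[ye yt] /andP[we wt].
rewrite -(subrKA w) (le_trans (ler_normD _ _))// addrC lerD//.
  exact: (regular_subdifferential_bound L0 (fL _ ye)).
by rewrite distrC ltW.
Qed.

Lemma limiting_subdifferential_le_lip f x zeta L : 0 <= L ->
  lip_near f x L -> limiting_subdifferential f x zeta -> `|zeta| <= L.
Proof.
move=> L0 [e e0 fe] lim; rewrite -[zeta]subr0.
have dot0 y : dot 0 y = 0 by rewrite /dot big1// => j _; rewrite mxE mul0r.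
apply: (limiting_subdifferential_bound L0 _ lim); exists e => // y z ye ze.
by rewrite !dot0 !subr0 fe.
Qed.

Lemma regular_subdifferential_scale f x zeta (a : R) : 0 < a ->
  regular_subdifferential (fun y => a * f y) x zeta ->
  regular_subdifferential f x (a^-1 *: zeta).
Proof.
move=> a0 reg e e0; apply: filterS (reg (a * e) (mulr_gt0 a0 e0)) => y.
move=> h; rewrite dotZl -(ler_pM2l a0) !mulrBr mulrA divff ?gt_eqF// mul1r.
by rewrite mulrN mulrA.
Qed.

(** For [a = 0] the subgradient is 0 and carries no information on [v]; nonemptiness is what
    provides a witness then. *)
Lemma limiting_subdifferential_scale f x zeta (a L : R) : 0 <= a -> 
  lip_near f x L -> limiting_subdifferential f x !=set0 ->
  limiting_subdifferential (fun y => a * f y) x zeta ->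
  exists2 v, limiting_subdifferential f x v & zeta = a *: v.
Proof.
rewrite le_eqVlt => /predU1P[<-|a0] fL [v0 fv0] lim.
  exists v0 => //; rewrite scale0r; apply/eqP; rewrite -normr_le0.
  apply: limiting_subdifferential_le_lip lim => //.
  by exists 1 => // y z _ _; rewrite !mul0r subrr normr0.
exists (a^-1 *: zeta); last by rewrite scalerA divff ?gt_eqF// scale1r.
apply/limiting_subdifferential_approxP => e e0.
move/limiting_subdifferential_approxP : lim.
move=> /(_ (Num.min e (a * e)))[|y [w [yx fy wz reg]]].
  by rewrite lt_min e0 mulr_gt0.
move: yx fy wz; rewrite !lt_min => /andP[ye _] /andP[_ fy] /andP[_ we].
exists y, (a^-1 *: w); split => //.
- by move: fy; rewrite -mulrBr normrM gtr0_norm// ltr_pM2l.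
- by rewrite -scalerBr normrZ gtr0_norm ?invr_gt0// ltr_pdivrMl.
- exact: regular_subdifferential_scale.
Qed.

End LimitingObjects.

(** * The limiting sum rule *)

Lemma row_entry_continuous (R : realType) (d N : nat) (i : 'I_N) :
  continuous (fun V : 'rV['rV[R]_d]_N => V 0 i).
Proof.
move=> V s /= /(nbhs_ballP (V 0 i)) [e e0 es].
by apply/nbhs_ballP; exists e => //= W [_ VW]; exact/es/VW.
Qed.

Lemma dot_sqrD (R : realType) (d : nat) (u v : 'rV[R]_d) :
  dot (u + v) (u + v) = dot u u + 2 * dot u v + dot v v.
Proof. by rewrite dotDl !dotDr (dotC v u); ring. Qed.

Section SumRule.
Variables (R : realType) (d N : nat) (phi : 'I_N -> 'rV[R]_d -> R).
Variables (C : set 'rV[R]_d) (xb : 'rV[R]_d) (r L : R).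
Hypotheses (clC : closed C) (Cxb : C xb) (r0 : 0 < r) (L0 : 0 <= L).
Hypothesis phiL : forall i y z, `|y - xb| < r -> `|z - xb| < r ->
  `|phi i y - phi i z| <= L * `|y - z|.
Hypothesis xbmin : forall z, C z -> `|z - xb| < r ->
  \sum_i phi i xb <= \sum_i phi i z.

(** Only [z] is constrained to [C], so stationarity in a copy [Y i] yields a subgradient and
    stationarity in [z] a normal vector. *)
Let decoupled (j : R) (Y : 'I_N -> 'rV[R]_d) z :=
  \sum_i phi i (Y i) + j * (\sum_i dot (Y i - z) (Y i - z)) + dot (z - xb) (z - xb).

Let phi_lip i y : `|y - xb| < r -> lip_near (phi i) y L.
Proof.
move=> yr; have fL : lip_near (phi i) xb L by exists r => //; exact: phiL.
exists (r - `|y - xb|); first by rewrite subr_gt0.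
have aux z : `|z - y| < r - `|y - xb| -> `|z - xb| < r.
  by rewrite ltrBrDr; apply: le_lt_trans; rewrite ler_distD.
by move=> z w /aux ? /aux ?; exact: phiL.
Qed.

Let half_lt : r / 2 < r.
Proof. by rewrite ltr_pdivrMr// mulr_natr mulr2n ltrDl. Qed.

Let decoupled_cvg (T : Type) (F : set_system T) {FF : Filter F} (j : R)
    (Y : T -> 'I_N -> 'rV[R]_d) (z : T -> 'rV[R]_d) (Yl : 'I_N -> 'rV[R]_d)
    (zl : 'rV[R]_d) :
  (forall i, Y t i @[t --> F] --> Yl i) -> (forall i, `|Yl i - xb| < r) ->
  z @ F --> zl -> decoupled j (Y t) (z t) @[t --> F] --> decoupled j Yl zl.
Proof.
move=> YF Yr zF; apply: cvgD; last first.
  have zxF : z t - xb @[t --> F] --> zl - xb by exact: cvgB zF (cvg_cst _).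
  exact: (cvg_dot zxF zxF).
apply: cvgD.
  apply: cvg_sumr => i _; apply: continuous_cvg (YF i).
  by apply: (@lip_near_continuous _ _ _ _ L); apply: phi_lip.
apply: cvgM; first exact: cvg_cst.
apply: cvg_sumr => i _.
have YzF : Y t i - z t @[t --> F] --> Yl i - zl by exact: cvgB (YF i) zF.
exact: (cvg_dot YzF YzF).
Qed.

(** The closed ball of radius [r / 2] is compact and lies inside the open ball where the [phi i] are
    Lipschitz. All points are packed into one row of vectors to use compactness of a product: entry
    0 holds [z], the lifted entries hold the copies. *)
Let decoupled_min j : exists Y z,
  [/\ C z, `|z - xb| <= r / 2, forall i, `|Y i - xb| <= r / 2
    & forall Y' z', C z' -> `|z' - xb| <= r / 2 ->
        (forall i, `|Y' i - xb| <= r / 2) -> decoupled j Y z <= decoupled j Y' z'].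
Proof.
pose B := [set y : 'rV[R]_d | `|y - xb| <= r / 2].
pose A (i : 'I_N.+1) := if i == ord0 then B `&` C else B.
pose K := [set V : 'rV['rV[R]_d]_N.+1 | forall i, A i (V ord0 i)].
pose E (V : 'rV['rV[R]_d]_N.+1) :=
  decoupled j (fun i => V 0 (lift ord0 i)) (V 0 0).
pose row Y z : 'rV['rV[R]_d]_N.+1 :=
  \row_i (if unlift ord0 i is Some i' then Y i' else z).
have row0 Y z : row Y z 0 0 = z by rewrite mxE unlift_none.
have rowS Y z i : row Y z 0 (lift ord0 i) = Y i by rewrite mxE liftK.
have Krow Y z : C z -> B z -> (forall i, B (Y i)) -> K (row Y z).
  move=> Cz Bz BY i; rewrite /A; case: (unliftP ord0 i) => [i' ->|->].
    by rewrite rowS eq_sym (negPf (neq_lift _ _)).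
  by rewrite row0 eqxx.
have KA V : K V -> [/\ C (V 0 0), B (V 0 0) & forall i, B (V 0 (lift ord0 i))].
  move=> KV; have := KV ord0; rewrite /A eqxx => -[? ?]; split=> // i.
  by have := KV (lift ord0 i); rewrite /A eq_sym (negPf (neq_lift _ _)).
have Bxb : B xb by rewrite /B /= subrr normr0 divr_ge0// ltW.
have cK : compact K.
  apply: rV_compact => i; rewrite /A; case: ifP => _; last exact: box_compact.
  by apply: compact_closedI => //; exact: box_compact.
have [| |V /set_mem /KA[CV BV BVi] Vmin] := @compact_EVT_min _ R E K _ cK.
- by exists (row (fun=> xb) xb); apply: Krow.
- apply: continuous_in_subspaceT => V /set_mem /KA[CV BV BVi].
  have entry i : (fun W : 'rV['rV[R]_d]_N.+1 => W 0 i) @ V --> V 0 i.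
    exact: row_entry_continuous.
  apply: (@decoupled_cvg _ (nbhs V) (nbhs_filter V) j
    (fun W i => W 0 (lift ord0 i)) (fun W => W 0 0)) => // i.
  by rewrite (le_lt_trans (BVi i)).
exists (fun i => V 0 (lift ord0 i)), (V 0 0); split => // Y' z' Cz' Bz' BY'.
have := Vmin (row Y' z'); rewrite inE => /(_ (Krow _ _ Cz' Bz' BY')).
rewrite /E row0; congr (_ <= decoupled j _ z').
by apply/funext => i; rewrite rowS.
Qed.

(** In the sum of the first-order conditions at a decoupled minimizer the penalty terms cancel, and
    only [2 *: (z - xb)] is left; it is small once [j] is large. *)
Lemma fuzzy_sum_rule e : 0 < e -> exists Y z xi eta,
  [/\ forall i, `|Y i - xb| < e /\ regular_subdifferential (phi i) (Y i) (xi i),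
      `|z - xb| < e, regular_normal_cone C z eta,
      `|\sum_i xi i + eta| < e & forall i, `|xi i| <= L].
Proof.
move=> e0.
(* The copies will lie within [2 * m] of [xb]: at most [e / 2], and at most [r / 2], which makes the
   minimizer interior to the ball. The residual will be below [2 * m] as well. *)
have [m [m0 m4]] : exists m, 0 < m /\ m <= e / 4 /\ m <= r / 4.
  by exists (Num.min (e / 4) (r / 4)); rewrite lt_min !ge_min !lexx orbT !divr_gt0.
have [NL NLE] : {NL | NL = N%:R * L + 1} by exists (N%:R * L + 1).
have NL0 : 0 < NL by rewrite NLE ltr_wpDl// mulr_ge0// ler0n.
have [del [del0 delm delNL]] :
    exists del, [/\ 0 < del, del <= m & del * NL <= m ^+ 2].
  exists (Num.min m (m ^+ 2 / NL)); split.
  - by rewrite lt_min m0 divr_gt0// exprn_gt0.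
  - by rewrite ge_min lexx.
  - by rewrite -ler_pdivlMr// ge_min lexx orbT.
(* Chosen so that [j * |Y i - z|^2 < r * NL] gives [|Y i - z| < del]; in turn [del * NL <= m ^+ 2]
   will give [|z - xb| < m]. *)
have [j jE] : {j | j = (r * NL) / del ^+ 2} by eexists.
have j0 : 0 < j by rewrite jE divr_gt0 ?mulr_gt0 ?exprn_gt0.
have [Y [z [Cz zr Yr Ymin]]] := decoupled_min j.
(* The competitor puts all points at [xb]; minimality of [xb] at [z] and the Lipschitz bound then
   replace the difference of the values of the [phi i]. *)
have lowsum : j * (\sum_i dot (Y i - z) (Y i - z)) + dot (z - xb) (z - xb)
    <= \sum_i L * `|Y i - z|.
  have r20 : `|xb - xb| <= r / 2 by rewrite subrr normr0 divr_ge0// ltW.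
  have := Ymin (fun=> xb) xb Cxb r20 (fun=> r20).
  have dot00 : dot (xb - xb) (xb - xb) = 0.
    by rewrite subrr /dot big1// => k _; rewrite mxE mul0r.
  have S0 : \sum_(i < N) dot (xb - xb) (xb - xb) = 0 by rewrite big1.
  rewrite /decoupled S0 dot00 mulr0 !addr0 => le1.
  have := xbmin Cz (le_lt_trans zr half_lt).
  have : \sum_i (phi i z - phi i (Y i)) <= \sum_i L * `|Y i - z|.
    apply: ler_sum => i _; rewrite (le_trans (ler_norm _))// distrC.
    by apply: phiL; apply: le_lt_trans half_lt.
  rewrite sumrB; lra.
have normYz i : `|Y i - z| <= r.
  rewrite -(subrKA xb) (le_trans (ler_normD _ _))// [leRHS]splitr lerD//.
  by rewrite distrC.
have sumbound (b : R) : (forall i, `|Y i - z| <= b) -> 0 <= b ->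
    \sum_i L * `|Y i - z| <= b * (N%:R * L).
  move=> Yb b0; apply: (@le_trans _ _ (\sum_(i < N) L * b)).
    by apply: ler_sum => i _; rewrite ler_wpM2l.
  by rewrite sumr_const card_ord -mulr_natl; lra.
(* Bootstrap: the crude bound [r] on [|Y i - z|] in [lowsum] gives [del] here, and [del] put back
   into [lowsum] bounds [|z - xb|] next. *)
have Ydel i : `|Y i - z| < del.
  rewrite -(ltr_pXn2r (_ : 0 < 2)%N) ?nnegrE ?normr_ge0 ?(ltW del0)//.
  apply: (@le_lt_trans _ _ (dot (Y i - z) (Y i - z))); first exact: sqr_norm_le_dot.
  have : j * dot (Y i - z) (Y i - z) < r * NL.
    have := sumbound r normYz (ltW r0).
    have : j * dot (Y i - z) (Y i - z) <= j * (\sum_i dot (Y i - z) (Y i - z)).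
      rewrite ler_pM2l// (bigD1 i)//= lerDl sumr_ge0// => k _; exact: dot_ge0.
    have := dot_ge0 (z - xb); rewrite NLE mulrDr mulr1; lra.
  by rewrite -ltr_pdivlMl// jE invf_div divfK// gt_eqF// mulr_gt0.
have zm : `|z - xb| < m.
  rewrite -(ltr_pXn2r (_ : 0 < 2)%N) ?nnegrE ?normr_ge0 ?(ltW m0)//.
  apply: (@le_lt_trans _ _ (dot (z - xb) (z - xb))); first exact: sqr_norm_le_dot.
  have := sumbound del (fun i => ltW (Ydel i)) (ltW del0).
  have : 0 <= j * (\sum_i dot (Y i - z) (Y i - z)).
    by rewrite mulr_ge0 ?(ltW j0)// sumr_ge0// => k _; exact: dot_ge0.
  move: delNL; rewrite NLE mulrDr mulr1; lra.
have Ym i : `|Y i - xb| < m + m.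
  rewrite -(subrKA z) (le_lt_trans (ler_normD _ _))// ltrD//.
  exact: lt_le_trans (Ydel i) delm.
(* [xi i] and [eta] are minus the gradients of the quadratic terms in [Y i] and in [z]. *)
pose xi i := (2 * j) *: (z - Y i).
pose eta := - (\sum_i xi i + 2 *: (z - xb)).
have jd0 : 0 < j * (d%:R + 1) by rewrite mulr_gt0// ltr_wpDl.
have reg i : regular_subdifferential (phi i) (Y i) (xi i).
  move=> t t0; apply/near_norm.
  exists (Num.min (r / 2 - `|Y i - xb|) (t / (j * (d%:R + 1)))).
    rewrite lt_min subr_gt0 divr_gt0// andbT (lt_le_trans (Ym i))//.
    by case: m4; lra.
  move=> y; rewrite lt_min => /andP[yr yt].
  have yb : `|y - xb| <= r / 2.
    by move: yr; rewrite ltrBrDr => /ltW; apply: le_trans; rewrite ler_distD.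
  pose Y' k := if k == i then y else Y k.
  have Y'r k : `|Y' k - xb| <= r / 2 by rewrite /Y'; case: eqP.
  have := Ymin Y' z Cz zr Y'r.
  have upd (F : 'I_N -> 'rV[R]_d -> R) :
      \sum_k F k (Y' k) = \sum_k F k (Y k) + (F i y - F i (Y i)).
    rewrite (bigD1 i)//= [X in _ = X + _](bigD1 i)//= /Y' eqxx.
    rewrite (eq_bigr (fun k => F k (Y k))) => [|k /negPf ->//]; ring.
  rewrite /decoupled (upd phi) (upd (fun _ w => dot (w - z) (w - z))).
  move=> le1.
  have h1 : y - z = (y - Y i) + (Y i - z) by rewrite subrKA.
  have h2 : dot (y - z) (y - z) = dot (y - Y i) (y - Y i)
     - 2 * dot (z - Y i) (y - Y i) + dot (Y i - z) (Y i - z).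
    by rewrite h1 dot_sqrD -(opprB (Y i) z) dotNl (dotC (Y i - z)); ring.
  have h3 : j * dot (y - Y i) (y - Y i) <= t * `|y - Y i|.
    have := dot_norm_le (y - Y i) (y - Y i).
    rewrite (ger0_norm (dot_ge0 _)) => h3.
    have h4 : j * (d%:R + 1) * `|y - Y i| <= t.
      by rewrite mulrC -ler_pdivlMr// ltW.
    apply: (@le_trans _ _ (j * (d%:R + 1) * `|y - Y i| * `|y - Y i|)).
      rewrite -mulrA -mulrA ler_pM2l//; apply: le_trans h3 _.
      by rewrite ler_wpM2r ?mulr_ge0// lerDl.
    by rewrite ler_wpM2r.
  rewrite /xi dotZl; move: le1; rewrite h2 !mulrDr; lra.
exists Y, z, xi, eta; split.
- by move=> i; split=> //; rewrite (lt_le_trans (Ym i))//; case: m4; lra.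
- by rewrite (lt_le_trans zm)//; case: m4; lra.
- split=> // t t0; apply/near_norm.
  pose M := (j * N%:R + 1) * (d%:R + 1).
  have M0 : 0 < M.
    by rewrite mulr_gt0// ltr_wpDl// mulr_ge0// ?ler0n// ltW.
  exists (Num.min (r / 2 - `|z - xb|) (t / M)).
    rewrite lt_min subr_gt0 divr_gt0// andbT (lt_le_trans zm)//.
    by case: m4; lra.
  move=> z'; rewrite lt_min => /andP[z'r z't] Cz'.
  have z'b : `|z' - xb| <= r / 2.
    by move: z'r; rewrite ltrBrDr => /ltW; apply: le_trans; rewrite ler_distD.
  have := Ymin Y z' Cz' z'b Yr; rewrite /decoupled -!addrA lerD2l.
  set w := z' - z.
  have h1 i : dot (Y i - z') (Y i - z') =
      dot (Y i - z) (Y i - z) + (2 * dot (z - Y i) w + dot w w).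
    have -> : Y i - z' = - w + (Y i - z) by rewrite /w opprB [RHS]addrC subrKA.
    rewrite dot_sqrD -(opprB (Y i) z) !dotNl dotNr opprK (dotC w (Y i - z)).
    by ring.
  have -> : z' - xb = w + (z - xb) by rewrite subrKA.
  rewrite (eq_bigr _ (fun i _ => h1 i)) !big_split /= -mulr_sumr -dot_suml.
  rewrite sumr_const card_ord dot_sqrD => h2.
  have h3 : (j * N%:R + 1) * dot w w <= t * `|w|.
    have := dot_norm_le w w; rewrite (ger0_norm (dot_ge0 _)) => h3.
    have h4 : M * `|w| <= t by rewrite mulrC -ler_pdivlMr// ltW.
    apply: (@le_trans _ _ (M * `|w| * `|w|)).
      rewrite /M -2!mulrA ler_wpM2l ?addr_ge0 ?mulr_ge0 ?ler0n ?(ltW j0)//.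
      by apply: le_trans h3 _; rewrite ler_wpM2r ?mulr_ge0// lerDl.
    by rewrite ler_wpM2r.
  have h4 : \sum_i xi i = (2 * j) *: \sum_i (z - Y i) by rewrite scaler_sumr.
  rewrite /eta h4 dotNl dotDl !dotZl.
  move: h2 h3; rewrite -mulr_natl (dotC w (z - xb)); lra.
- rewrite /eta opprD addrA subrr add0r normrN normrZ ger0_norm//.
  by case: m4; lra.
- move=> i; rewrite -[xi i]subr0.
  apply: regular_subdifferential_bound (reg i) => //.
  have [|t t0 tP] := @phi_lip i (Y i).
    by rewrite (lt_le_trans (Ym i))//; case: m4; lra.
  exists t => // y y' yt y't; have dot0 u : dot 0 u = 0 :> R.
    by rewrite /dot big1// => k _; rewrite mxE mul0r.
  by rewrite !dot0 !subr0 tP.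
Qed.

(** The fuzzy subgradients are bounded by [L] and so converge along an ultrafilter. No bound on the
    normals is required: their sum with the subgradients tends to 0, which forces their limit to be
    minus the sum of the limits. *)
Lemma limiting_sum_rule : exists xi eta,
  [/\ forall i, limiting_subdifferential (phi i) xb (xi i),
      limiting_normal_cone C xb eta & \sum_i xi i + eta = 0].
Proof.
have /choice[D DP] : forall k : nat, exists D : ('I_N -> 'rV[R]_d) * 'rV[R]_d
      * ('I_N -> 'rV[R]_d) * 'rV[R]_d,
    let: (Y, z, xi, eta) := D in
  [/\ forall i, `|Y i - xb| < k.+1%:R^-1 /\
        regular_subdifferential (phi i) (Y i) (xi i),
      `|z - xb| < k.+1%:R^-1, regular_normal_cone C z eta,
      `|\sum_i xi i + eta| < k.+1%:R^-1 & forall i, `|xi i| <= L].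
  move=> k; have [|Y [z [xi [eta H]]]] := @fuzzy_sum_rule k.+1%:R^-1.
    by rewrite invr_gt0.
  by exists (Y, z, xi, eta).
have [U [UU Uoo]] := ultra_nat.
have small (e : R) : 0 < e -> \forall k \near U, k.+1%:R^-1 < e.
  move=> e0; apply: Uoo; have [K Ke] := inv_succ_lt e0; exists K => // k /= Kk.
  by rewrite (le_lt_trans _ Ke)// lef_pV2 ?posrE// ler_nat.
have /choice[xi xiP] : forall i, exists l : 'rV[R]_d, (D k).1.2 i @[k --> U] --> l.
  move=> i; apply: (@ultra_bounded_cvg _ _ U _ _ L).
  apply: nearW => k; have := DP k; case: (D k) => [[[Y z] x] eta] [_ _ _ _].
  exact.
exists xi, (- \sum_i xi i); split; last by rewrite subrr.
- move=> i; apply: limiting_subdifferential_closed.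
    apply: (@lip_near_continuous _ _ _ _ L); apply: phi_lip.
    by rewrite subrr normr0.
  move=> e e0.
  have [k [ke xik]] := filter_ex (filterI (small e e0) (cvg_near_dist (xiP i) e0)).
  move: (DP k) xik; case: (D k) => [[[Y z] x] eta] [/(_ i)[Yk reg] _ _ _ _] /= xik.
  exists (Y i), (x i); split=> //; first exact: lt_trans ke.
  apply/limiting_subdifferential_approxP => t t0.
  by exists (Y i), (x i); rewrite !subrr !normr0.
- apply: limiting_normal_cone_closed => // e e0.
  have e20 : 0 < e / 2 by rewrite divr_gt0.
  have sumxi : \sum_i (D k).1.2 i @[k --> U] --> \sum_i xi i.
    by apply: cvg_sumr => i _; exact: xiP.
  have [k [ke xik]] := filter_ex (filterI (small _ e20) (cvg_near_dist sumxi e20)).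
  move: (DP k) xik; case: (D k) => [[[Y z] x] eta] [_ zk reg sumk _] /= xik.
  have e2e : e / 2 < e by rewrite ltr_pdivrMr// mulr_natr mulr2n ltrDl.
  exists z, eta; split; first exact: lt_trans zk (lt_trans ke e2e).
    have -> : eta - - (\sum_i xi i) =
        (\sum_i x i + eta) - (\sum_i x i - \sum_i xi i).
      by rewrite opprB [RHS]addrC addrA subrK opprK addrC.
    rewrite (le_lt_trans (ler_normB _ _))// [ltRHS]splitr ltrD//.
    exact: lt_trans ke.
  apply/limiting_normal_cone_approxP; split=> [|t t0]; first by case: reg.
  by exists z, eta; rewrite !subrr !normr0.
Qed.

End SumRule.

(** * Normal cones of products *)

Section Blocks.
Variables (R : realType) (l : nat) (q : 'I_l -> nat).
Variable D : forall i, set 'rV[R]_(q i).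
Arguments D : clear implicits.
Local Notation Rd := 'rV[R]_(\sum_i q i).
Implicit Types (x z u v : Rd).
Let prodD : set Rd := [set x : Rd | forall i, D i (submxrow x i)].

Lemma submxrow_norm x (i : 'I_l) : `|submxrow x i| <= `|x|.
Proof.
by apply: rV_norm_le => // j; rewrite mxE; exact: rV_norm_coord.
Qed.

Lemma submxrowZ (a : R) x (i : 'I_l) : submxrow (a *: x) i = a *: submxrow x i.
Proof. by apply/rowP => j; rewrite !mxE. Qed.

Lemma mxrow_norm_le (B : forall i, 'rV[R]_(q i)) M :
  0 <= M -> (forall i, `|B i| <= M) -> `|\mxrow_i B i| <= M.
Proof.
move=> M0 BM; apply: rV_norm_le => // j; rewrite mxE.
exact: le_trans (rV_norm_coord _ _) (BM _).
Qed.

Lemma dot_blocks u v : dot u v = \sum_i dot (submxrow u i) (submxrow v i).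
Proof.
have dotE n (a b : 'rV[R]_n) : dot a b = (a *m b^T) 0 0.
  by rewrite mxE; apply: eq_bigr => j _; rewrite mxE.
rewrite dotE -{1}(submxrowK u) -{1}(submxrowK v) tr_mxrow mul_mxrow_mxcol.
by rewrite summxE; apply: eq_bigr => i _; rewrite dotE.
Qed.

Lemma submxrow_cvg (T : Type) (F : set_system T) {FF : Filter F} (u : T -> Rd)
    (x : Rd) (i : 'I_l) :
  u @ F --> x -> submxrow (u t) i @[t --> F] --> submxrow x i.
Proof.
move=> ux; apply/cvgrPdist_lt => e e0; apply: filterS (cvg_near_dist ux e0) => t.
by rewrite distrC -submxrowB; exact: le_lt_trans (submxrow_norm _ _).
Qed.

Lemma closed_prod : (forall i, closed (D i)) -> closed prodD.
Proof.
move=> clD x xcl i; apply: clD => B /near_norm[e e0 eB].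
have [|y [Dy yx]] := xcl [set y : Rd | `|y - x| < e].
  by apply/near_norm; exists e.
exists (submxrow y i); split; first exact: Dy.
by apply: eB; rewrite -submxrowB (le_lt_trans (submxrow_norm _ _)).
Qed.

(** One direction moves a single block and freezes the others; the other direction shares the
    tolerance among the blocks. *)
Lemma regular_normal_cone_prod z v :
  regular_normal_cone prodD z v <->
  forall i, regular_normal_cone (D i) (submxrow z i) (submxrow v i).
Proof.
split=> [[Dz reg] i|reg].
  split=> // e e0; have /near_norm[t t0 tP] := reg e e0.
  apply/near_norm; exists t => // u ut Du.
  pose z' : Rd := \mxrow_j eqtype.dfwith (fun j => submxrow z j) u j.
  have z'E j : submxrow z' j = eqtype.dfwith (fun j => submxrow z j) u j.
    by rewrite mxrowK.
  have z'i : submxrow (z' - z) i = u - submxrow z i.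
    by rewrite submxrowB z'E dfwith_in.
  have z'j j : i != j -> submxrow (z' - z) j = 0.
    by move=> ij; rewrite submxrowB z'E dfwith_out// subrr.
  have z'n : `|z' - z| <= `|u - submxrow z i|.
    rewrite -[z' - z]submxrowK; apply: mxrow_norm_le => // j.
    by have [<-|ij] := eqVneq i j; rewrite ?z'i// z'j// normr0.
  have Dz' : prodD z'.
    move=> j; rewrite z'E; have [<-|ij] := eqVneq i j; first by rewrite dfwith_in.
    by rewrite dfwith_out//; exact: Dz.
  have := tP z' (le_lt_trans z'n ut) Dz'.
  rewrite dot_blocks (bigD1 i)//= z'i big1 ?addr0; last first.
    move=> j ji; rewrite z'j 1?eq_sym// /dot big1// => k _.
    by rewrite [X in _ * X]mxE mulr0.
  by move=> /le_trans; apply; rewrite ler_wpM2l// ltW.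
split=> [i|e e0]; first by have [] := reg i.
(* The summand 1 keeps the share positive when there are no blocks. *)
pose e' := e / (l%:R + 1).
have l0 : 0 < l%:R + 1 :> R by rewrite ltr_wpDl.
have e'0 : 0 < e' by rewrite divr_gt0.
have H : \forall z' \near z, forall i : 'I_l, D i (submxrow z' i) ->
    dot (submxrow v i) (submxrow z' i - submxrow z i) <=
    e' * `|submxrow z' i - submxrow z i|.
  apply: (@filter_forall _ _ _ (nbhs z) (nbhs_filter z)) => i; have [_ /(_ e' e'0)/near_norm[t t0 tP]] := reg i.
  apply/near_norm; exists t => // z' z't; apply: tP.
  by rewrite -submxrowB (le_lt_trans (submxrow_norm _ _)).
apply: filterS H => z' z'P Dz'; rewrite dot_blocks.
apply: (@le_trans _ _ (\sum_(i < l) e' * `|z' - z|)).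
  apply: ler_sum => i _; rewrite submxrowB (le_trans (z'P i (Dz' i)))//.
  by rewrite -submxrowB ler_wpM2l ?submxrow_norm// ltW.
rewrite sumr_const card_ord -mulr_natl mulrA ler_wpM2r//.
by rewrite /e' mulrCA ger_pMr// ler_pdivrMr// mul1r lerDl.
Qed.

Lemma limiting_normal_cone_block x v i :
  limiting_normal_cone prodD x v ->
  limiting_normal_cone (D i) (submxrow x i) (submxrow v i).
Proof.
move=> [Dx [x_ [v_ [reg xx vv]]]]; split; first exact: Dx.
exists (fun k => submxrow (x_ k) i), (fun k => submxrow (v_ k) i); split.
- by move=> k; have [Dk /regular_normal_cone_prod] := reg k.
- exact: submxrow_cvg xx.
- exact: submxrow_cvg vv.
Qed.

(** The regular normals approximating [v] can be rescaled block by block at unchanged base points.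
    This keeps a vector normal after the reduction has given its blocks different coefficients. *)
Lemma limiting_normal_cone_block_scale x v (b : 'I_l -> R) :
  (forall i, 0 <= b i) -> limiting_normal_cone prodD x v ->
  limiting_normal_cone prodD x (\mxrow_i (b i *: submxrow v i)).
Proof.
move=> b0 /limiting_normal_cone_approxP[Dx H].
apply/limiting_normal_cone_approxP; split=> // e e0.
pose M := \sum_i b i + 1.
have M0 : 0 < M by rewrite ltr_wpDl// sumr_ge0.
have [|x' [v' [x'x v'v reg]]] := H (Num.min (e / M) e / 2).
  by rewrite divr_gt0// lt_min e0 divr_gt0.
have mlt : Num.min (e / M) e / 2 < Num.min (e / M) e.
  by rewrite ltr_pdivrMr// mulr_natr mulr2n ltrDl lt_min e0 divr_gt0.
have := lt_trans x'x mlt; rewrite lt_min => /andP[_ x'e].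
have : Num.min (e / M) e / 2 < e / M by rewrite (lt_le_trans mlt)// ge_min lexx.
move: v'v; set t := Num.min (e / M) e / 2 => v'v tM.
exists x', (\mxrow_i (b i *: submxrow v' i)); split=> //.
- have t0 : 0 <= t by rewrite (le_trans _ (ltW v'v)).
  have bM i : b i <= M.
    by rewrite /M (bigD1 i)//= -addrA lerDl addr_ge0// sumr_ge0.
  rewrite -mxrowB (@le_lt_trans _ _ (M * t))//; last by rewrite mulrC -ltr_pdivlMr.
  apply: mxrow_norm_le => [|i]; first by rewrite mulr_ge0// ltW.
  rewrite -scalerBr -submxrowB normrZ ger0_norm// ler_pM//.
  by rewrite (le_trans (submxrow_norm _ _))// ltW.
- apply/regular_normal_cone_prod => i; rewrite mxrowK.
  move/regular_normal_cone_prod : reg => /(_ i)[Di reg]; split=> // s s0.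
  pose s' := s / (b i + 1).
  have bi0 : 0 < b i + 1 by rewrite ltr_wpDl.
  have s'0 : 0 < s' by rewrite divr_gt0.
  apply: filterS (reg s' s'0) => y yP /yP h; rewrite dotZl.
  apply: (@le_trans _ _ (b i * (s' * `|y - submxrow x' i|))).
    by rewrite ler_wpM2l.
  rewrite mulrA ler_wpM2r// /s' mulrCA ger_pMr//.
  by rewrite ler_pdivrMr// mul1r lerDl.
Qed.

End Blocks.

(** * Linear independence *)

(** Independence of a family over a set of indices: as with [free], equal vectors at distinct
    indices count as dependent, while supports of multipliers can be handled as sets. *)
Definition lin_indep (K : fieldType) (V : vectType K) (T : finType)
    (w : T -> V) (A : {set T}) : Prop :=
  forall c : T -> K, \sum_(t in A) c t *: w t = 0 -> forall t, t \in A -> c t = 0.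

Section LinearIndependence.
Variables (K : fieldType) (V : vectType K) (T : finType) (w : T -> V).
Implicit Types (s : seq T) (A B : {set T}).

Lemma span_mapP s v : uniq s -> v \in <<map w s>>%VS ->
  exists c : T -> K, v = \sum_(t <- s) c t *: w t.
Proof.
elim: s v => [|t s IH] v /=.
  move=> _; rewrite span_nil memv0 => /eqP ->; exists (fun=> 0).
  by rewrite big_nil.
move=> /andP[ts us]; rewrite span_cons => /memv_addP[u /vlineP[a ->] [u' u's ->]].
have [c ->] := IH _ us u's; exists (fun t' => if t' == t then a else c t').
rewrite big_cons eqxx; congr (_ + _); apply: eq_big_seq => t' t's.
by case: eqP => // tt'; rewrite -tt' t's in ts.
Qed.

Lemma sum_map_span s (c : T -> K) : \sum_(t <- s) c t *: w t \in <<map w s>>%VS.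
Proof.
rewrite big_seq; apply: rpred_sum => t ts; apply/rpredZ/memv_span.
exact: map_f.
Qed.

Lemma free_mapP s : uniq s ->
  free (map w s) <-> lin_indep w [set t in s]%SET.
Proof.
move=> us; rewrite /lin_indep.
have sumE (c : T -> K) : \sum_(t in [set t in s]%SET) c t *: w t = \sum_(t <- s) c t *: w t.
  by rewrite big_uniq//; apply: eq_bigl => t; rewrite inE.
suff : free (map w s) <-> (forall c : T -> K, \sum_(t <- s) c t *: w t = 0 ->
    forall t, t \in s -> c t = 0).
  move=> ->; split=> H c; first by rewrite sumE => /H h t; rewrite inE; exact: h.
  by rewrite -sumE => /H h t ts; apply: h; rewrite inE.
elim: s us {sumE} => [_|t s IH /= /andP[ts us]].
  by rewrite nil_free; split.
rewrite free_cons; split=> [/andP[wt fs] c|H].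
  rewrite big_cons; have [ct0|ct0] := eqVneq (c t) 0.
    rewrite ct0 scale0r add0r => /(proj1 (IH us) fs) h u.
    by rewrite inE => /predU1P[->//|]; exact: h.
  move=> /eqP; rewrite addr_eq0 => /eqP h.
  move: wt; rewrite -[w t](scalerK ct0) h rpredZ//.
  by rewrite rpredN sum_map_span.
apply/andP; split; last first.
  apply/(IH us) => c c0 u uS.
  have := H (fun t' => if t' == t then 0 else c t').
  rewrite big_cons eqxx scale0r add0r (eq_big_seq (fun u => c u *: w u)); last first.
    by move=> t' t's; case: eqP => // tt'; rewrite -tt' t's in ts.
  move=> /(_ c0 u); rewrite inE uS orbT => /(_ isT).
  by case: eqP => // ut; rewrite -ut uS in ts.
apply/negP => /(span_mapP us)[c wtE].
have := H (fun t' => if t' == t then -1 else c t').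
rewrite big_cons eqxx scaleN1r (eq_big_seq (fun u => c u *: w u)); last first.
  by move=> t' t's; case: eqP => // tt'; rewrite -tt' t's in ts.
rewrite -wtE addNr => /(_ erefl t); rewrite mem_head eqxx => /(_ isT)/eqP.
by rewrite oppr_eq0 oner_eq0.
Qed.

Lemma free_subseq s : exists s',
  [/\ subseq s' s, free (map w s') & <<map w s'>>%VS = <<map w s>>%VS].
Proof.
elim: s => [|t s [s' [ss' fs' es']]]; first by exists [::]; rewrite nil_free.
case: (boolP (w t \in <<map w s>>%VS)) => wt.
  exists s'; split=> //; first by rewrite (subseq_trans ss')// subseq_cons.
  rewrite es' /= span_cons; apply/esym/addv_idPr.
  by rewrite -memvE.
exists (t :: s'); split; first by rewrite /= eqxx.
  by rewrite /= free_cons fs' andbT es'.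
by rewrite /= !span_cons es'.
Qed.

Lemma lin_indep_sub A B : B \subset A -> lin_indep w A -> lin_indep w B.
Proof.
move=> BA lA c cB t tB.
have := lA (fun t => if t \in B then c t else 0); rewrite (big_setID B) /=.
rewrite (finset.setIidPr BA) (eq_bigr (fun t => c t *: w t)) => [|u ->//].
rewrite cB add0r big1 => [/(_ erefl t)|u].
  by rewrite tB; apply; exact: (fintype.subsetP BA _ tB).
by rewrite inE => /andP[/negPf ->]; rewrite scale0r.
Qed.

Lemma lin_indep_scale (a : T -> K) A : (forall t, t \in A -> a t != 0) ->
  lin_indep w A -> lin_indep (fun t => a t *: w t) A.
Proof.
move=> a0 lA c cA t tA; have := lA (fun t => c t * a t).
under eq_bigr do rewrite -scalerA.
by move=> /(_ cA t tA)/eqP; rewrite mulf_eq0 (negPf (a0 t tA)) orbF => /eqP.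
Qed.

Lemma eq_lin_indep (w' : T -> V) A : (forall t, t \in A -> w t = w' t) ->
  lin_indep w A -> lin_indep w' A.
Proof.
move=> ww' lA c cA; apply: lA; rewrite -[RHS]cA.
by apply: eq_bigr => t tA; rewrite ww'.
Qed.

End LinearIndependence.

(** Subtract a multiple of a dependence relation [c'], with the factor [a t / c' t] of least
    absolute value over the indices outside [B] where [c'] is nonzero. One coefficient outside [B]
    disappears and no other one outside [B] changes sign. Independence of [B] guarantees that the
    relation reaches outside [B]. *)
Lemma signed_caratheodory (R : realFieldType) (V : vectType R) (T : finType)
    (w : T -> V) (B : {set T}) (a : T -> R) :
  lin_indep w B ->
  exists b : T -> R, [/\ \sum_t b t *: w t = \sum_t a t *: w t,
    forall t, t \notin B -> b t = 0 \/ 0 < a t * b t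
    & lin_indep w (B :|: [set t | b t != 0])%SET].
Proof.
move=> lB; pose out (a : T -> R) := ([set t | a t != 0] :\: B)%SET.
have [n] := ubnP #|out a|; elim: n a => // n IH a an.
pose A := (B :|: [set t | a t != 0])%SET.
have [lA|nlA] := pselect (lin_indep w A).
  exists a; split => // t _; have [->|a0] := eqVneq (a t) 0; first by left.
  by right; rewrite -expr2 exprn_even_gt0.
have [c [c0 [t1 ct1]]] : exists c : T -> R,
    (\sum_(t in A) c t *: w t = 0 /\ exists t, (t \in A) && (c t != 0)).
  apply: contrapT => H; apply: nlA => c c0 t tA; apply/eqP; apply: contrapT => ct.
  by apply: H; exists c; split=> //; exists t; rewrite tA; apply/negP.
pose c' t := if t \in A then c t else 0.
have c'0 : \sum_t c' t *: w t = 0.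
  rewrite -[RHS]c0 [RHS]big_mkcond; apply: eq_bigr => t _.
  by rewrite /c'; case: ifP => // _; rewrite scale0r.
pose P t := (t \notin B) && (c' t != 0).
have [t2 Pt2] : exists t, P t.
  apply: contrapT => H.
  have c'B t : t \notin B -> c' t = 0.
    move=> tB; apply/eqP; apply: contrapT => ct; apply: H; exists t.
    by rewrite /P tB; apply/negP.
  have : \sum_(t in B) c' t *: w t = 0.
    rewrite -[RHS]c'0 [LHS]big_mkcond; apply: eq_bigr => t _.
    by case: ifP => // /negbT/c'B ->; rewrite scale0r.
  move=> /lB c'B1; case/andP: ct1 => t1A /negP; apply; apply/eqP.
  have -> : c t1 = c' t1 by rewrite /c' t1A.
  by case: (boolP (t1 \in B)) => [/c'B1|/c'B].
case: (@arg_minP _ _ _ t2 P (fun t => `|a t / c' t|) Pt2) => t0 /andP[t0B ct0] t0min.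
pose s := a t0 / c' t0.
pose a' t := a t - s * c' t.
have a't0 : a' t0 = 0 by rewrite /a' /s divfK// subrr.
have sign t : t \notin B -> a' t = 0 \/ 0 < a t * a' t.
  move=> tB; have [ct|ct] := eqVneq (c' t) 0.
    rewrite /a' ct mulr0 subr0; have [->|a0] := eqVneq (a t) 0; first by left.
    by right; rewrite -expr2 exprn_even_gt0.
  have [->|a't] := eqVneq (a' t) 0; [by left|right].
  have at0 : a t != 0.
    by move: ct; rewrite /c'; case: ifP; rewrite ?eqxx// !inE (negPf tB).
  rewrite lt_def mulf_neq0//=.
  rewrite /a' mulrBr subr_ge0 (le_trans (ler_norm _))// normrM.
  have -> : a t * a t = `|a t| * `|a t|.
    by rewrite -normrM ger0_norm// -expr2 sqr_ge0.
  rewrite ler_wpM2l// normrM.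
  rewrite -ler_pdivlMr ?normr_gt0// -normfV -normrM; apply: t0min.
  by rewrite /P tB.
have suma' : \sum_t a' t *: w t = \sum_t a t *: w t.
  under eq_bigr do rewrite scalerBl -scalerA.
  by rewrite sumrB -scaler_sumr c'0 scaler0 subr0.
have [|b [bE bs bl]] := IH a'.
  rewrite -ltnS (leq_trans _ an)// ltnS proper_card//; apply/properP; split.
    apply/fintype.subsetP => t; rewrite !inE => /andP[tB a't]; rewrite tB/=.
    by apply: contra_neq a't => at0; case: (sign t tB) => //; rewrite at0 mul0r ltxx.
  exists t0; last by rewrite !inE a't0 eqxx andbF.
  rewrite !inE t0B /=; move: ct0; rewrite /c'; case: ifP; rewrite ?eqxx//.
  by rewrite !inE (negPf t0B).
exists b; split=> //; first by rewrite bE.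
move=> t tB; case: (bs t tB) => [|ab]; first by left.
case: (sign t tB) => [a't|aa']; first by rewrite a't mul0r ltxx in ab.
(* Having the same sign is transitive: the square of the intermediate coefficient [a' t] is divided
   out. *)
right; have : 0 < a t * b t * a' t ^+ 2.
  have -> : a t * b t * a' t ^+ 2 = a t * a' t * (a' t * b t) by ring.
  exact: mulr_gt0.
have a't : a' t != 0 by apply: contraTneq ab => ->; rewrite mul0r ltxx.
by rewrite pmulr_lgt0// exprn_even_gt0.
Qed.

Lemma ultra_bounded_cvg_real (R : realType) (U : set_system nat)
  (UU : UltraFilter U) (u : nat -> R) M :
  (\forall k \near U, `|u k| <= M) -> exists l : R, u @ U --> l.
Proof.
move=> uM; have [|L uL] := @ultra_bounded_cvg R 1 U UU (fun k => const_mx (u k)) M.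
  apply: filterS uM => k ukM; apply: rV_norm_le => [|j]; last by rewrite mxE.
  exact: le_trans ukM.
exists (L 0 0); apply/cvgrPdist_lt => e e0.
apply: filterS (cvg_near_dist uL e0) => k; apply: le_lt_trans.
by rewrite distrC (le_trans _ (rV_norm_coord _ 0))// !mxE.
Qed.

(** Otherwise there are dependence relations at points tending to [x]; normalized to largest
    coefficient 1, they converge along an ultrafilter to a nontrivial relation at [x]. *)
Lemma lin_indep_near (R : realType) (d : nat) (T : finType)
    (w : 'rV[R]_d -> T -> 'rV[R]_d) x (A : {set T}) :
  (forall t, t \in A -> {for x, continuous (w ^~ t)}) ->
  lin_indep (w x) A -> \forall y \near x, lin_indep (w y) A.
Proof.
move=> wx lA; apply/near_norm; apply: contrapT => H.
have /choice[u uP] : forall k : nat, exists u : 'rV[R]_d * (T -> R),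
    [/\ `|u.1 - x| < k.+1%:R^-1, \sum_(t in A) u.2 t *: w u.1 t = 0,
        forall t, t \in A -> `|u.2 t| <= 1 & 1 <= \sum_(t in A) `|u.2 t|].
  move=> k; apply: contrapT => Hk; apply: H; exists k.+1%:R^-1.
    by rewrite invr_gt0.
  move=> y yx c c0 t tA; apply/eqP; apply: contrapT => ct; apply: Hk.
  case: (@arg_maxP _ _ _ t (mem A) (fun t => `|c t|) tA) => t0 t0A t0max.
  have ct0 : 0 < `|c t0|.
    by rewrite (lt_le_trans _ (t0max t tA))// normr_gt0; apply/negP.
  exists (y, fun t => (c t0)^-1 * c t); split=> //=.
  - under eq_bigr do rewrite -scalerA.
    by rewrite -scaler_sumr c0 scaler0.
  - move=> t' t'A; rewrite normrM normfV ler_pdivrMl// mulr1; exact: t0max.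
  - rewrite (bigD1 t0)//= mulVf -?normr_gt0// normr1 lerDl.
    by apply: sumr_ge0 => *; exact: normr_ge0.
have [U [UU Uoo]] := ultra_nat.
have xU : (u k).1 @[k --> U] --> x.
  have xoo : (u k).1 @[k --> \oo] --> x.
    by apply: cvg_inv_succ => k; have [] := uP k.
  by move=> B /xoo; exact: Uoo.
have /choice[c cP] : forall t, exists l : R, t \in A -> (u k).2 t @[k --> U] --> l.
  move=> t; case: (boolP (t \in A)) => tA; last by exists 0.
  have [|l lP] := @ultra_bounded_cvg_real R U UU (fun k => (u k).2 t) 1.
    by apply: nearW => k; have [_ _ + _] := uP k; apply.
  by exists l.
have c0 : \sum_(t in A) c t *: w x t = 0.
  have F : \sum_(t in A) (u k).2 t *: w (u k).1 t @[k --> U] -->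
      \sum_(t in A) c t *: w x t.
    apply: cvg_sumr => t tA; apply: cvgZ; first exact: cP.
    by move=> B /(wx t tA)/xU.
  apply/esym/(cvg_unique _ _ F); first exact: norm_hausdorff.
  rewrite (_ : (fun k => _) = fun=> 0); first exact: cvg_cst.
  by apply/funext => k; have [] := uP k.
have F : \sum_(t in A) `|(u k).2 t| @[k --> U] --> \sum_(t in A) `|c t|.
  by apply: cvg_sumr => t tA; apply: cvg_norm; exact: cP.
have : 1 <= \sum_(t in A) `|c t|.
  apply: (closed_cvg _ (@closed_ge _ 1) _ _ F).
  by apply: nearW => k; have [] := uP k.
by rewrite big1 ?ler10// => t tA; rewrite (lA c c0 t tA) normr0.
Qed.

(** * Multipliers of penalized problems *)

Section Smooth.
Variables (R : realType) (d : nat).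
Implicit Types (f g : 'rV[R]_d -> R) (x y c : 'rV[R]_d).

Lemma gradientP f x v : differentiable f x -> 'd f x v = dot (gradient f x) v.
Proof.
move=> df; rewrite {1}(row_sum_delta v) linear_sum /dot; apply: eq_bigr => j _.
by rewrite linearZ /= mxE deriveE// [LHS]mulrC.
Qed.

Lemma differentiable_near f x (e : R) : differentiable f x -> 0 < e ->
  \forall y \near x, `|f y - f x - dot (gradient f x) (y - x)| <= e * `|y - x|.
Proof.
move=> df e0; have /eqaddoP/(_ e e0)/near_norm[t t0 tP] := diff_locally df.
apply/near_norm; exists t => // y yt.
have := tP (y - x); rewrite subr0 => /(_ yt) /=.
by rewrite -gradientP// !fctE /= subrK opprD addrA.
Qed.

(** A Lipschitz condition with one end fixed at [x]. Differentiability at [x] alone implies it, and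
    it makes the squared increment negligible against [|y - x|]. *)
Definition calm f x := exists L, \forall y \near x, `|f y - f x| <= L * `|y - x|.

Lemma lip_near_calm f x L : lip_near f x L -> calm f x.
Proof.
case=> e e0 fe; exists L; apply/near_norm; exists e => // y ye.
by apply: fe => //; rewrite subrr normr0.
Qed.

Lemma differentiable_calm f x : differentiable f x -> calm f x.
Proof.
move=> df; exists (1 + d%:R * `|gradient f x|).
apply: filterS (differentiable_near df ltr01) => y; rewrite mul1r => h.
rewrite -[f y - f x](subrK (dot (gradient f x) (y - x))).
rewrite (le_trans (ler_normD _ _))// mulrDl mul1r lerD//.
by rewrite -mulrA dot_norm_le.
Qed.

Lemma calm_sqr f x (k e : R) : calm f x -> 0 < e ->
  \forall y \near x, k * (f y - f x) ^+ 2 <= e * `|y - x|.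
Proof.
move=> [L /near_norm[t t0 tP]] e0; apply/near_norm.
pose M := `|k| * L ^+ 2 + 1.
have M0 : 0 < M by rewrite ltr_wpDl// mulr_ge0// sqr_ge0.
exists (Num.min t (e / M)) => [|y]; first by rewrite lt_min t0 divr_gt0.
rewrite lt_min => /andP[/tP yL yM].
have kM : `|k| * L ^+ 2 <= M by rewrite lerDl.
apply: (@le_trans _ _ (`|k| * (L * `|y - x|) ^+ 2)).
  apply: (@le_trans _ _ (`|k| * (f y - f x) ^+ 2)).
    by rewrite ler_wpM2r ?sqr_ge0// ler_norm.
  rewrite ler_wpM2l// -[leLHS]real_normK ?num_real//.
  by rewrite ler_pXn2r// nnegrE// (le_trans _ yL).
rewrite exprMn mulrA (expr2 `|y - x|) mulrA ler_wpM2r//.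
apply: (@le_trans _ _ (M * `|y - x|)); first by rewrite ler_wpM2r.
by rewrite mulrC -ler_pdivlMr// ltW.
Qed.

Lemma calm_dist x : calm (fun y => `|y - x|) x.
Proof.
exists 1; apply/near_norm; exists 1 => // y _; rewrite subrr normr0 subr0 normr_id mul1r.
exact: lexx.
Qed.

Lemma lip_near_linear_norm c x (b e : R) : 0 <= e ->
  lip_near (fun y => (b + dot c y + e * `|y - x|) - dot c y) x e.
Proof.
move=> e0; exists 1 => // y z _ _.
have -> : b + dot c y + e * `|y - x| - dot c y - (b + dot c z + e * `|z - x| - dot c z)
  = e * (`|y - x| - `|z - x|) by ring.
rewrite normrM ger0_norm// ler_wpM2l// (le_trans (ler_dist_dist _ _))//.
by rewrite opprB addrA subrK.
Qed.

Lemma lip_near_add_linear f c x (L : R) : 0 <= L ->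
  lip_near (fun y => f y - dot c y) x L ->
  lip_near f x (L + d%:R * `|c|).
Proof.
move=> L0 [e e0 fe]; exists e => // y z ye ze.
have -> : f y - f z = (f y - dot c y - (f z - dot c z)) + dot c (y - z).
  by rewrite dotBr; ring.
rewrite (le_trans (ler_normD _ _))// mulrDl lerD ?fe//.
by rewrite -mulrA dot_norm_le.
Qed.

Lemma lip_near_le f x (L L' : R) : L <= L' -> lip_near f x L -> lip_near f x L'.
Proof.
move=> LL' [e e0 fe]; exists e => // y z ye ze.
by rewrite (le_trans (fe _ _ ye ze))// ler_wpM2r.
Qed.

Lemma lip_near_scale f x (a L : R) : lip_near f x L ->
  lip_near (fun y => a * f y) x (`|a| * L).
Proof.
move=> [e e0 fe]; exists e => // y z ye ze.
by rewrite -mulrBr normrM -mulrA ler_wpM2l// fe.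
Qed.

End Smooth.

Lemma limiting_sum_rule_near (R : realType) (d N : nat)
    (phi : 'I_N -> 'rV[R]_d -> R) (C : set 'rV[R]_d) x :
  closed C -> C x -> (forall i, exists L, lip_near (phi i) x L) ->
  (\forall y \near x, C y -> \sum_i phi i x <= \sum_i phi i y) ->
  exists xi eta,
  [/\ forall i, limiting_subdifferential (phi i) x (xi i),
      limiting_normal_cone C x eta & \sum_i xi i + eta = 0].
Proof.
move=> clC Cx /choice[L phiL] /near_norm[r0 r00 rmin].
pose M := \sum_i `|L i|.
have M0 : 0 <= M by apply: sumr_ge0.
have phiM i : lip_near (phi i) x M.
  apply: lip_near_le (phiL i); rewrite (le_trans (ler_norm _))//.
  by rewrite /M (bigD1 i)//= lerDl sumr_ge0.
have /choice[r rP] : forall i, exists r, 0 < r /\ forall y z, `|y - x| < r ->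
    `|z - x| < r -> `|phi i y - phi i z| <= M * `|y - z|.
  by move=> i; have [r ? ?] := phiM i; exists r.
pose r' := \big[Num.min/r0]_i r i.
have r'0 : 0 < r' by apply: lt_bigmin => // i _; have [] := rP i.
apply: (@limiting_sum_rule _ _ _ phi C x r' M) => //.
  move=> i y z yr zr; have [_] := rP i; apply.
    by rewrite (lt_le_trans yr)// bigmin_le_cond.
  by rewrite (lt_le_trans zr)// bigmin_le_cond.
move=> z Cz zr; apply: rmin => //.
by rewrite (lt_le_trans zr)// bigmin_le_id.
Qed.

Lemma limiting_subdifferential_nonempty (R : realType) (d : nat)
    (g : 'rV[R]_d -> R) x L :
  lip_near g x L -> limiting_subdifferential g x !=set0.
Proof.
(* every point minimizes g + (-g) *)
move=> gL.
have [||xi [_ [/(_ ord0) + _ _]]] := @limiting_sum_rule_near R d 2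
    (fun i y => (-1) ^+ i * g y) setT x closedT I.
- move=> i; exists (`|(-1) ^+ i| * L); exact: lip_near_scale.
- apply/near_norm; exists 1 => // y _ _; rewrite !big_ord_recl !big_ord0 /=.
  by rewrite /bump /= expr0 expr1 !mul1r !mulN1r !addr0 !subrr.
- rewrite /= expr0 => h; exists (xi ord0).
  by congr (limiting_subdifferential _ _ _) : h; apply/funext => y; rewrite mul1r.
Qed.

Section PenalizedMultipliers.
Variables (R : realType) (d N : nat) (M : finType).
Variables (f : 'rV[R]_d -> R) (g : 'I_N -> 'rV[R]_d -> R) (u : M -> 'rV[R]_d -> R).
Variables (C : set 'rV[R]_d) (x c : 'rV[R]_d) (a : 'I_N -> R) (b : M -> R) (K : R).

(** The [u t] are only differentiable at [x], so they cannot enter the sum rule as Lipschitz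
    functions. They are linearized into [psi], whose cone [e * |y - x|] also pays for every
    quadratic term; the price is an error [e] in the conclusion. *)
Lemma penalized_multipliers e :
  closed C -> C x -> (exists L, lip_near f x L) ->
  (forall i, exists L, lip_near (g i) x L) -> (forall t, differentiable (u t) x) ->
  (forall i, 0 <= a i) ->
  (\forall y \near x, C y -> f x <= f y + \sum_i a i * (g i y - g i x)
     + \sum_t b t * (u t y - u t x) + dot c (y - x)
     + (\sum_i K * (g i y - g i x) ^+ 2 + \sum_t K * (u t y - u t x) ^+ 2
        + K * dot (y - x) (y - x))) ->
  0 < e ->
  exists zeta v eta, [/\ limiting_subdifferential f x zeta,
    forall i, limiting_subdifferential (g i) x (v i),
    limiting_normal_cone C x eta
  & `|zeta + \sum_i a i *: v i + \sum_t b t *: gradient (u t) x + c + eta| <= e].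
Proof.
move=> clC Cx [Lf fL] gL du a0 xmin e0.
(* The number of remainders sharing [e]: squares of the [g i], squares of the [u t], linearization
   errors of the [u t], and the term [K * dot (y - x) (y - x)]. *)
pose Q : R := N%:R + #|M|%:R + #|M|%:R + 1.
have Q0 : 0 < Q by rewrite /Q ltr_wpDl// !addr_ge0// ler0n.
pose e1 := e / Q; have e10 : 0 < e1 by rewrite divr_gt0.
pose c' := \sum_t b t *: gradient (u t) x + c.
pose psi y := (- dot c' x) + dot c' y + e * `|y - x|.
pose phi (i : 'I_N.+2) : 'rV[R]_d -> R :=
  if unlift ord0 i is Some j then
    if unlift ord0 j is Some k then fun y => a k * g k y else psi
  else f.
have phi0 : phi ord0 = f by rewrite /phi unlift_none.
have phi1 : phi (lift ord0 ord0) = psi by rewrite /phi liftK unlift_none.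
have phi2 i : phi (lift ord0 (lift ord0 i)) = fun y => a i * g i y.
  by rewrite /phi !liftK.
have sumphi y : \sum_i phi i y = f y + (psi y + \sum_i a i * g i y).
  rewrite !big_ord_recl phi0 phi1; congr (_ + (_ + _)).
  by apply: eq_bigr => i _; rewrite phi2.
have psiL := lip_near_linear_norm c' x (- dot c' x) (ltW e0).
have phiL i : exists L, lip_near (phi i) x L.
  have [j ->|->] := unliftP ord0 i; last by rewrite phi0; exists Lf.
  have [k ->|->] := unliftP ord0 j; last first.
    by rewrite phi1; exists (e + d%:R * `|c'|); apply: lip_near_add_linear (ltW _) psiL.
  have [L gk] := gL k; rewrite phi2; exists (`|a k| * L).
  exact: lip_near_scale.
have gsq : \forall y \near x, forall i, K * (g i y - g i x) ^+ 2 <= e1 * `|y - x|.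
  apply: (@filter_forall _ _ _ (nbhs x) (nbhs_filter x)) => i.
  have [L gi] := gL i; exact: calm_sqr (lip_near_calm gi) e10.
have usq : \forall y \near x, forall t, K * (u t y - u t x) ^+ 2 <= e1 * `|y - x|.
  apply: (@filter_forall _ _ _ (nbhs x) (nbhs_filter x)) => t.
  exact: calm_sqr (differentiable_calm (du t)) e10.
have ulin : \forall y \near x, forall t,
    b t * (u t y - u t x) <= b t * dot (gradient (u t) x) (y - x) + e1 * `|y - x|.
  apply: (@filter_forall _ _ _ (nbhs x) (nbhs_filter x)) => t.
  have bt0 : 0 < `|b t| + 1 by rewrite ltr_wpDl.
  apply: filterS (differentiable_near (du t) (divr_gt0 e10 bt0)) => y h.
  rewrite -lerBlDl -mulrBr (le_trans (ler_norm _))// normrM.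
  apply: (@le_trans _ _ ((`|b t| + 1) * (e1 / (`|b t| + 1) * `|y - x|))).
    by rewrite ler_pM// lerDl.
  by rewrite mulrA mulrCA divff ?mulr1// gt_eqF.
have nsq : \forall y \near x, K * dot (y - x) (y - x) <= e1 * `|y - x|.
  apply: filterS (calm_sqr (`|K| * d%:R) (calm_dist x) e10) => y.
  rewrite subrr normr0 subr0; apply: le_trans.
  rewrite (le_trans (ler_norm _))// normrM -mulrA ler_wpM2l// expr2.
  exact: dot_norm_le.
have phimin : \forall y \near x, C y -> \sum_i phi i x <= \sum_i phi i y.
  have fI := @filterI _ (nbhs x) (nbhs_filter x).
  have H := fI _ _ (fI _ _ xmin gsq) (fI _ _ (fI _ _ usq ulin) nsq).
  apply: (@filterS _ (nbhs x) (nbhs_filter x) _ _ _ H) => y [[ymin yg] [[yu yl] yn]] Cy.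
  rewrite !sumphi /psi subrr normr0 mulr0 addr0.
  have s1 : \sum_i K * (g i y - g i x) ^+ 2 <= N%:R * (e1 * `|y - x|).
    apply: (le_trans (ler_sum _ (fun i _ => yg i))).
    by rewrite sumr_const card_ord mulr_natl.
  have s2 : \sum_t K * (u t y - u t x) ^+ 2 <= #|M|%:R * (e1 * `|y - x|).
    apply: (le_trans (ler_sum _ (fun i _ => yu i))).
    by rewrite sumr_const mulr_natl.
  have s3 : \sum_t b t * (u t y - u t x) + dot c (y - x)
      <= dot c' (y - x) + #|M|%:R * (e1 * `|y - x|).
    rewrite /c' dotDl dot_suml addrAC lerD2r.
    apply: (le_trans (ler_sum _ (fun i _ => yl i))).
    rewrite big_split /= sumr_const [X in _ <= _ + X]mulr_natl lerD2r.
    by apply: ler_sum => t _; rewrite dotZl.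
  have s4 : \sum_i a i * (g i y - g i x) = \sum_i a i * g i y - \sum_i a i * g i x.
    by rewrite -sumrB; apply: eq_bigr => i _; rewrite mulrBr.
  have s5 : e * `|y - x| = N%:R * (e1 * `|y - x|) + #|M|%:R * (e1 * `|y - x|)
      + #|M|%:R * (e1 * `|y - x|) + e1 * `|y - x|.
    have -> : e = Q * e1 by rewrite /e1 mulrCA divff ?mulr1// gt_eqF.
    by rewrite /Q; ring.
  have := ymin Cy; rewrite s4; move: s1 s2 s3 s5 yn.
  rewrite !(dotBr c) (dotBr c'); lra.
have [xi [eta [xiP etaP sum0]]] := limiting_sum_rule_near clC Cx phiL phimin.
have /choice[v vP] : forall i, exists v, limiting_subdifferential (g i) x v /\
    xi (lift ord0 (lift ord0 i)) = a i *: v.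
  move=> i; have [L gi] := gL i; have := xiP (lift ord0 (lift ord0 i)).
  rewrite phi2 => /(limiting_subdifferential_scale (a0 i) gi).
  by case=> [|v ? ?]; [exact: limiting_subdifferential_nonempty gi|exists v].
exists (xi ord0), v, eta; split=> //.
- by have := xiP ord0; rewrite phi0.
- by move=> i; have [] := vP i.
have xi1 : `|xi (lift ord0 ord0) - c'| <= e.
  have := xiP (lift ord0 ord0); rewrite phi1.
  exact: limiting_subdifferential_bound (ltW e0) psiL.
have -> : xi ord0 + \sum_i a i *: v i + \sum_t b t *: gradient (u t) x + c + eta
    = (\sum_i xi i + eta) + (c' - xi (lift ord0 ord0)).
  rewrite !big_ord_recl /c'.
  rewrite (eq_bigr (fun i => xi (lift ord0 (lift ord0 i)))) => [|i _]; last first.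
    by have [] := vP i.
  move: (xi ord0) (xi (lift _ _)) (\sum_(i < N) xi (lift ord0 (lift ord0 i)))
    (\sum_t b t *: gradient (u t) x) => w1 w2 w3 w4.
  by apply/rowP => j; rewrite !mxE; ring.
by rewrite sum0 add0r distrC.
Qed.

End PenalizedMultipliers.

(** * The complementarity penalty *)

Section ComplementarityPenalty.
Variable R : realType.
Implicit Types a b s t : R.

(** The squared positive part has the 2-Lipschitz derivative [2 * Num.max t 0], so it lies below its
    tangent plus the squared increment. *)
Lemma sqr_max_le s t :
  Num.max s 0 ^+ 2 <= Num.max t 0 ^+ 2 + 2 * Num.max t 0 * (s - t) + (s - t) ^+ 2.
Proof.
have s2 := sqr_ge0 s; have t2 := sqr_ge0 t; have st2 := sqr_ge0 (s - t).
case: (leP s 0) => hs; case: (leP t 0) => ht; try lra.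
have := mulr_ge0 (ltW hs) (_ : 0 <= - t); rewrite oppr_ge0 => /(_ ht); lra.
Qed.

Lemma sqr_min_le s t :
  Num.min s 0 ^+ 2 <= Num.min t 0 ^+ 2 + 2 * Num.min t 0 * (s - t) + (s - t) ^+ 2.
Proof.
have s2 := sqr_ge0 s; have t2 := sqr_ge0 t; have st2 := sqr_ge0 (s - t).
case: (leP s 0) => hs; case: (leP t 0) => ht; try lra.
have := mulr_ge0 (_ : 0 <= - s) (ltW ht); rewrite oppr_ge0 => /(_ hs); lra.
Qed.

Lemma sqr_le s t : s ^+ 2 <= t ^+ 2 + 2 * t * (s - t) + (s - t) ^+ 2.
Proof. by have := lexx (s ^+ 2); lra. Qed.

(** Compares the squared distances of [(a, b)] to the half-axis with second coordinate 0 and to the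
    one with first coordinate 0. *)
Definition compl_branch a b := Num.min a 0 ^+ 2 + b ^+ 2 <= a ^+ 2 + Num.min b 0 ^+ 2.

(* The squared distance of (a, b) to {0 <= y _|_ z >= 0}; a branch attaining
   the minimum is a smooth majorant touching it at (a, b). *)
Definition compl_pen a b :=
  Num.min (Num.min a 0 ^+ 2 + b ^+ 2) (a ^+ 2 + Num.min b 0 ^+ 2).

(** Half the partial derivatives of the squared distance to the selected half-axis. *)
Definition compl_resG a b := if compl_branch a b then Num.min a 0 else a.
Definition compl_resH a b := if compl_branch a b then b else Num.min b 0.

Lemma compl_penE a b : compl_pen a b = compl_resG a b ^+ 2 + compl_resH a b ^+ 2.
Proof.
rewrite /compl_pen /compl_resG /compl_resH /compl_branch.
by case: (leP (Num.min a 0 ^+ 2 + b ^+ 2)).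
Qed.

Lemma compl_pen_ge0 a b : 0 <= compl_pen a b.
Proof. by rewrite compl_penE addr_ge0// sqr_ge0. Qed.

Lemma compl_pen_le a b a' b' :
  compl_pen a' b' <= compl_pen a b
    + 2 * compl_resG a b * (a' - a) + 2 * compl_resH a b * (b' - b)
    + (a' - a) ^+ 2 + (b' - b) ^+ 2.
Proof.
rewrite (compl_penE a b) /compl_resG /compl_resH; case: ifP => _.
  apply: (@le_trans _ _ (Num.min a' 0 ^+ 2 + b' ^+ 2)).
    by rewrite /compl_pen ge_min lexx.
  have := sqr_min_le a' a; have := sqr_le b' b; lra.
apply: (@le_trans _ _ (a' ^+ 2 + Num.min b' 0 ^+ 2)).
  by rewrite /compl_pen ge_min lexx orbT.
have := sqr_min_le b' b; have := sqr_le a' a; lra.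
Qed.

(** If both arguments are nonpositive, the two branches cost the same and the residuals are [a] and
    [b]. If one is positive, the nearer half-axis leaves at most one nonzero residual. *)
Lemma compl_res_sign a b :
  (compl_resG a b < 0 /\ compl_resH a b < 0) \/ compl_resG a b * compl_resH a b = 0.
Proof.
rewrite /compl_resG /compl_resH; case: ifPn; rewrite /compl_branch.
  case: (leP a 0) => ha; last by right; rewrite mul0r.
  case: (leP b 0) => hb h.
    have [->|b0] := eqVneq b 0; first by right; rewrite mulr0.
    have [->|a0] := eqVneq a 0; first by right; rewrite mul0r.
    by left; split; rewrite lt_neqAle ?a0 ?b0.
  by exfalso; nra.
rewrite -ltNge; case: (leP b 0) => hb; last by right; rewrite mulr0.
case: (leP a 0) => ha h; last by exfalso; nra.
have [->|b0] := eqVneq b 0; first by right; rewrite mulr0.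
have [->|a0] := eqVneq a 0; first by right; rewrite mul0r.
by left; split; rewrite lt_neqAle ?a0 ?b0.
Qed.

(** The situation near [xs] for an index of [idxI]: the half-axis with first coordinate 0 is nearer,
    so the [H] constraint receives no multiplier. *)
Lemma compl_resH_eq0 a b : `|a| < b -> compl_resH a b = 0.
Proof.
rewrite ltr_norml => /andP[h1 h2]; rewrite /compl_resH /compl_branch.
case: ifP => h; last by case: (leP b 0) => //; lra.
by exfalso; move: h; case: (leP a 0) => ha; case: (leP b 0) => hb; nra.
Qed.

Lemma compl_resG_eq0 a b : `|b| < a -> compl_resG a b = 0.
Proof.
rewrite ltr_norml => /andP[h1 h2]; rewrite /compl_resG /compl_branch.
case: ifPn => h; first by case: (leP a 0) => //; lra.
exfalso; move: h; rewrite -ltNge.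
by case: (leP a 0) => ha; case: (leP b 0) => hb; nra.
Qed.

Lemma compl_pen_eq0 a b : compl_pen a b = 0 <-> [/\ 0 <= a, 0 <= b & a * b = 0].
Proof.
split=> [|[a0 b0 /eqP]].
  move/eqP; rewrite compl_penE paddr_eq0 ?sqr_ge0// !sqrf_eq0.
  rewrite /compl_resG /compl_resH; case: ifP => _ /andP[/eqP a0 /eqP b0].
    rewrite b0 mulr0; split=> //.
    by move: a0; case: (leP a 0) => [_ ->|/ltW].
  rewrite a0 mul0r; split=> //.
  by move: b0; case: (leP b 0) => [_ ->|/ltW].
rewrite mulf_eq0 => ab; apply/eqP; rewrite eq_le compl_pen_ge0 andbT.
rewrite /compl_pen ge_min; case/orP: ab => /eqP ->.
  by rewrite (min_r b0) expr0n addr0 lexx orbT.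
by rewrite (min_r a0) expr0n addr0 lexx.
Qed.

Lemma compl_res_eq0 a b : compl_pen a b = 0 ->
  compl_resG a b = 0 /\ compl_resH a b = 0.
Proof.
move/eqP; rewrite compl_penE paddr_eq0 ?sqr_ge0// !sqrf_eq0.
by move=> /andP[/eqP ? /eqP ?].
Qed.

Variables (T : Type) (F : set_system T).
Context {FF : Filter F}.

Lemma cvg_minr (u v : T -> R) s t : u @ F --> s -> v @ F --> t ->
  Num.min (u x) (v x) @[x --> F] --> Num.min s t.
Proof.
move=> us vt; rewrite minr_absE.
rewrite (_ : (fun x => Num.min (u x) (v x)) =
  (fun x => (u x + v x - `|u x - v x|) / 2)); last first.
  by apply/funext => x; rewrite minr_absE.
by apply: cvgMl; apply: cvgB; [exact: cvgD|apply: cvg_norm; exact: cvgB].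
Qed.

Lemma cvg_maxr (u v : T -> R) s t : u @ F --> s -> v @ F --> t ->
  Num.max (u x) (v x) @[x --> F] --> Num.max s t.
Proof.
move=> us vt; rewrite maxr_absE.
rewrite (_ : (fun x => Num.max (u x) (v x)) =
  (fun x => (u x + v x + `|u x - v x|) / 2)); last first.
  by apply/funext => x; rewrite maxr_absE.
by apply: cvgMl; apply: cvgD; [exact: cvgD|apply: cvg_norm; exact: cvgB].
Qed.

Lemma cvg_sqr (u : T -> R) s : u @ F --> s -> u x ^+ 2 @[x --> F] --> s ^+ 2.
Proof. by move=> us; exact: (cvgM us us). Qed.

Lemma cvg_compl_pen (u v : T -> R) s t : u @ F --> s -> v @ F --> t ->
  compl_pen (u x) (v x) @[x --> F] --> compl_pen s t.
Proof.
move=> us vt; have c0 : (fun=> 0 : R) @ F --> (0 : R) by exact: cvg_cst.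
apply: cvg_minr; apply: cvgD; apply: cvg_sqr => //; exact: cvg_minr.
Qed.

End ComplementarityPenalty.

(** * The penalty of the system *)

Section System.
Variables (R : realType) (n m p l : nat) (q : 'I_l -> nat).
Variables (S : csystem R n m p q).
Local Notation Rd := 'rV[R]_(\sum_i q i).
Implicit Types (x y z zeta eta : Rd) (v : 'I_n -> Rd).

Definition smooth_index : finType := ('I_m + ('I_p + 'I_p))%type.
Definition constr_index : finType := ('I_n + smooth_index)%type.

Definition smooth_constr (t : smooth_index) : Rd -> R :=
  match t with
  | inl i => sys_h S i
  | inr (inl i) => sys_Gi S i
  | inr (inr i) => sys_Hi S i
  end.

Definition constr_vec v x (t : constr_index) : Rd :=
  match t with
  | inl i => v i
  | inr t => gradient (smooth_constr t) x
  end.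

(* The multipliers of G and H are stored with the sign opposite to the one in
   the theorem, so that all terms enter the multiplier rule with a plus. *)
Definition signed_multiplier x (mu : constr_index -> R) : Prop :=
  [/\ forall i, 0 <= mu (inl i),
      forall i, i \notin activeg S x -> mu (inl i) = 0,
      forall i, i \notin idxI S x :|: idxJ S x -> mu (inr (inr (inl i))) = 0,
      forall i, i \notin idxK S x :|: idxJ S x -> mu (inr (inr (inr i))) = 0
    & forall i, i \in idxJ S x ->
        (mu (inr (inr (inl i))) < 0 /\ mu (inr (inr (inr i))) < 0) \/
        mu (inr (inr (inl i))) * mu (inr (inr (inr i))) = 0].

Definition penalty y : R :=
  \sum_i Num.max (sys_g S i y) 0 ^+ 2 + (\sum_i sys_h S i y ^+ 2 +
  \sum_i compl_pen (sys_Gi S i y) (sys_Hi S i y)).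

(** Half the slopes of the majorant of [penalty] touching it at [x]; scaled by [2 * k] these are the
    multipliers. *)
Definition residual x (t : constr_index) : R :=
  match t with
  | inl i => Num.max (sys_g S i x) 0
  | inr (inl i) => sys_h S i x
  | inr (inr (inl i)) => compl_resG (sys_Gi S i x) (sys_Hi S i x)
  | inr (inr (inr i)) => compl_resH (sys_Gi S i x) (sys_Hi S i x)
  end.

Lemma penalty_ge0 y : 0 <= penalty y.
Proof.
by rewrite !addr_ge0// sumr_ge0// => i _; rewrite ?sqr_ge0// compl_pen_ge0.
Qed.

Lemma penalty_eq0 x : penalty x = 0 -> prodC S x -> feasible S x.
Proof.
have s1 : 0 <= \sum_i Num.max (sys_g S i x) 0 ^+ 2.
  by apply: sumr_ge0 => i _; exact: sqr_ge0.
have s2 : 0 <= \sum_i sys_h S i x ^+ 2.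
  by apply: sumr_ge0 => i _; exact: sqr_ge0.
have s3 : 0 <= \sum_i compl_pen (sys_Gi S i x) (sys_Hi S i x).
  by apply: sumr_ge0 => i _; exact: compl_pen_ge0.
move/eqP; rewrite /penalty paddr_eq0 ?addr_ge0// paddr_eq0//.
move=> /andP[g0 /andP[h0 c0]] Cx.
have /(_ _ isT)g0' := psumr_eq0P (fun i _ => sqr_ge0 (Num.max (sys_g S i x) 0)) (eqP g0).
have /(_ _ isT)h0' := psumr_eq0P (fun i _ => sqr_ge0 (sys_h S i x)) (eqP h0).
have /(_ _ isT)c0' := psumr_eq0P
  (fun i _ => compl_pen_ge0 (sys_Gi S i x) (sys_Hi S i x)) (eqP c0).
split=> //.
- move=> i; have /eqP := g0' i; rewrite sqrf_eq0.
  by case: leP => // + /eqP g1; rewrite g1 ltxx.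
- by move=> i; have /eqP := h0' i; rewrite sqrf_eq0 => /eqP.
split=> /=.
- by move=> i; have [] := (compl_pen_eq0 _ _).1 (c0' i).
- rewrite /dot big1// => i _; by have [] := (compl_pen_eq0 _ _).1 (c0' i).
- by move=> i; have [] := (compl_pen_eq0 _ _).1 (c0' i).
Qed.

Lemma feasible_compl x i : feasible S x ->
  [/\ 0 <= sys_Gi S i x, 0 <= sys_Hi S i x & sys_Gi S i x * sys_Hi S i x = 0].
Proof.
case=> _ _ [/= G0 GH H0] _; split; [exact: G0|exact: H0|].
by have /(_ i isT) := psumr_eq0P (fun j _ => mulr_ge0 (G0 j) (H0 j)) GH.
Qed.

Lemma feasible_residual x t : feasible S x -> residual x t = 0.
Proof.
move=> Fx; case: (Fx) => g0 h0 _ _.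
case: t => [i|[i|[i|i]]] //=; first by rewrite max_r.
- by have [] := compl_res_eq0 ((compl_pen_eq0 _ _).2 (feasible_compl i Fx)).
- by have [] := compl_res_eq0 ((compl_pen_eq0 _ _).2 (feasible_compl i Fx)).
Qed.

Lemma feasible_penalty x : feasible S x -> penalty x = 0.
Proof.
move=> Fx; case: (Fx) => g0 h0 _ _; rewrite /penalty !big1 ?addr0// => i _.
- exact/compl_pen_eq0/feasible_compl.
- by rewrite h0 expr0n.
- by rewrite max_r// expr0n.
Qed.

Lemma penalty_le x y :
  penalty y <= penalty x
    + \sum_i 2 * residual x (inl i) * (sys_g S i y - sys_g S i x)
    + \sum_t 2 * residual x (inr t) * (smooth_constr t y - smooth_constr t x)
    + (\sum_i (sys_g S i y - sys_g S i x) ^+ 2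
       + \sum_t (smooth_constr t y - smooth_constr t x) ^+ 2).
Proof.
rewrite !big_sumType /= /penalty.
have h1 := ler_sum (index_enum 'I_n) (fun i (_ : true) =>
  sqr_max_le (sys_g S i y) (sys_g S i x)).
have h2 := ler_sum (index_enum 'I_m) (fun i (_ : true) =>
  sqr_le (sys_h S i y) (sys_h S i x)).
have h3 := ler_sum (index_enum 'I_p) (fun i (_ : true) =>
  compl_pen_le (sys_Gi S i x) (sys_Hi S i x) (sys_Gi S i y) (sys_Hi S i y)).
rewrite !big_split /= in h1 h2 h3; lra.
Qed.

Lemma penalty_cvg x :
  (forall i, {for x, continuous (sys_g S i)}) ->
  (forall t, {for x, continuous (smooth_constr t)}) ->
  {for x, continuous penalty}.
Proof.
suff H (T : Type) (F : set_system T) (FF : Filter F) (u : T -> Rd) :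
    (forall i, sys_g S i (u k) @[k --> F] --> sys_g S i x) ->
    (forall t, smooth_constr t (u k) @[k --> F] --> smooth_constr t x) ->
    penalty (u k) @[k --> F] --> penalty x.
  by move=> gx sx; apply: (H _ (nbhs x) (nbhs_filter x) id).
move=> gx sx; apply: cvgD.
  apply: cvg_sumr => i _; apply: cvg_sqr; apply: cvg_maxr => //; exact: cvg_cst.
apply: cvgD; apply: cvg_sumr => i _; first exact: cvg_sqr (sx (inl i)).
exact: cvg_compl_pen (sx (inr (inl i))) (sx (inr (inr i))).
Qed.

End System.

(** * Approximate multipliers *)

Section Penalization.
Variables (R : realType) (n m p l : nat) (q : 'I_l -> nat).
Variables (S : csystem R n m p q).
Local Notation Rd := 'rV[R]_(\sum_i q i).
Variables (f : Rd -> R) (xs : Rd).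
Hypotheses (hS : standing_assumptions S xs) (hf : lipschitz_around f xs)
  (hmin : local_minimizer f (feasible S) xs).
Implicit Types (x y z zeta eta : Rd) (v : 'I_n -> Rd).

Lemma local_region : exists2 r, 0 < r & forall x, `|x - xs| < r ->
  [/\ exists L, lip_near f x L, forall i, exists L, lip_near (sys_g S i) x L,
      forall t, differentiable (smooth_constr S t) x,
      feasible S x -> f xs <= f x
    & [/\ forall i, sys_g S i xs < 0 -> sys_g S i x < 0,
          forall i, i \in idxI S xs -> `|sys_Gi S i x| < sys_Hi S i x
        & forall i, i \in idxK S xs -> `|sys_Hi S i x| < sys_Gi S i x]].
Proof.
case: hS => _ gL hC GC HC; case: hmin => _ fmin.
have allI := @filter_forall _ _ _ (nbhs xs) (nbhs_filter xs).
have fI := @filterI _ (nbhs xs) (nbhs_filter xs).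
have lipE (u : Rd -> R) : lipschitz_around u xs ->
    \forall x \near xs, exists L, lip_near u x L.
  move=> /lipschitz_around_near[L L0 /lip_near_shift[e e0 H]].
  by apply/near_norm; exists e => // y /H; exists L.
have diffE t : \forall x \near xs, differentiable (smooth_constr S t) x.
  by case: t => [i|[i|i]]; [have := hC i|have := GC i|have := HC i];
    apply: filterS => y [].
have dist (u : Rd -> R) (e : R) : {for xs, continuous u} -> 0 < e ->
    \forall x \near xs, `|u x - u xs| < e.
  by move=> cu e0; exact: cvg_near_dist cu e0.
have smc t : {for xs, continuous (smooth_constr S t)}.
  apply: differentiable_continuous; have := diffE t.
  by move=> /near_norm[e e0]; apply; rewrite subrr normr0.
have gc i : {for xs, continuous (sys_g S i)}.
  by have [L _] := lipschitz_around_near (gL i); exact: lip_near_continuous.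
have E1 := allI _ _ (fun i => lipE _ (gL i)).
have E2 := allI _ _ diffE.
have E3 : \forall x \near xs, forall i, sys_g S i xs < 0 -> sys_g S i x < 0.
  apply: allI => i; case: (ltP (sys_g S i xs) 0) => g0; last first.
    by apply/near_norm; exists 1.
  have := dist _ (- sys_g S i xs) (gc i); rewrite oppr_gt0 => /(_ g0).
  by apply: filterS => y; rewrite ltr_norml => /andP[_] + _; lra.
have dom (u w : Rd -> R) : {for xs, continuous u} -> {for xs, continuous w} ->
    u xs = 0 -> 0 < w xs -> \forall x \near xs, `|u x| < w x.
  move=> uc wc u0 w0; have w20 : 0 < w xs / 2 by rewrite divr_gt0.
  apply: filterS (fI _ _ (dist _ _ uc w20) (dist _ _ wc w20)) => y [].
  by rewrite u0 subr0 (ltr_norml (w y - _)) => h /andP[h1 h2]; lra.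
have E4 : \forall x \near xs, forall i,
    i \in idxI S xs -> `|sys_Gi S i x| < sys_Hi S i x.
  apply: allI => i; case: (boolP (i \in idxI S xs)) => iI; last first.
    by apply/near_norm; exists 1.
  move: iI; rewrite inE => /andP[/eqP Gi Hi].
  have := dom _ _ (smc (inr (inl i))) (smc (inr (inr i))) Gi Hi.
  by apply: filterS => y + _.
have E5 : \forall x \near xs, forall i,
    i \in idxK S xs -> `|sys_Hi S i x| < sys_Gi S i x.
  apply: allI => i; case: (boolP (i \in idxK S xs)) => iI; last first.
    by apply/near_norm; exists 1.
  move: iI; rewrite inE => /andP[Gi /eqP Hi].
  have := dom _ _ (smc (inr (inr i))) (smc (inr (inl i))) Hi Gi.
  by apply: filterS => y + _.
have /near_norm[r r0 rP] := fI _ _ (fI _ _ (lipE f hf) (fI _ _ E1 E2))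
  (fI _ _ fmin (fI _ _ E3 (fI _ _ E4 E5))).
by exists r => // x /rP[[H1 [H2 H3]] [H4 [H5 [H6 H7]]]].
Qed.

Let FS : feasible S xs. Proof. by case: hmin. Qed.

Lemma penalized_minimizer (r : R) (k : nat) :
  0 < r -> (forall x, `|x - xs| <= r -> {for x, continuous f} /\
    {for x, continuous (penalty S)}) ->
  exists x, [/\ prodC S x, `|x - xs| <= r &
    forall y, prodC S y -> `|y - xs| <= r ->
      f x + dot (x - xs) (x - xs) + k%:R * penalty S x <=
      f y + dot (y - xs) (y - xs) + k%:R * penalty S y].
Proof.
move=> r0 cont; case: (hS) => clC _ _ _ _.
pose K := [set x : Rd | `|x - xs| <= r] `&` prodC S.
have cK : compact K.
  by apply: compact_closedI; [exact: box_compact|exact: closed_prod].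
have [| |x /set_mem [xr Cx] xmin] := @compact_EVT_min _ R
    (fun y => f y + dot (y - xs) (y - xs) + k%:R * penalty S y) K _ cK.
- by exists xs; split; rewrite /= ?subrr ?normr0 ?ltW//; case: FS.
- apply: continuous_in_subspaceT => x /set_mem [xr Cx].
  have [fc pc] := cont x xr.
  suff H (T : Type) (F : set_system T) (FF : Filter F) (u : T -> Rd) :
      u @ F --> x -> f (u t) @[t --> F] --> f x ->
      penalty S (u t) @[t --> F] --> penalty S x ->
      f (u t) + dot (u t - xs) (u t - xs) + k%:R * penalty S (u t) @[t --> F]
        --> f x + dot (x - xs) (x - xs) + k%:R * penalty S x.
    by apply: (H _ (nbhs x) (nbhs_filter x) id) => //; exact: cvg_id.
  move=> ux fu pu; apply: cvgD; last by apply: cvgM pu; exact: cvg_cst.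
  apply: cvgD => //.
  have uxs : u t - xs @[t --> F] --> x - xs by exact: cvgB ux (cvg_cst _).
  exact: (cvg_dot uxs uxs).
exists x; split=> // y Cy yr; apply: xmin; rewrite inE; split=> //.
Qed.

(** A limit point [xb] of the minimizers is feasible and satisfies [f xb + |xb - xs|^2 <= f xs].
    Local minimality of [xs] then leaves only [xb = xs], although [xs] need not be a strict
    minimizer of [f]. *)
Lemma penalized_minimizer_near (r e : R) :
  0 < r -> (forall x, `|x - xs| <= r -> [/\ {for x, continuous f},
    {for x, continuous (penalty S)} & feasible S x -> f xs <= f x]) -> 0 < e ->
  exists x (k : nat), [/\ prodC S x, `|x - xs| < e, `|x - xs| <= r &
    forall y, prodC S y -> `|y - xs| <= r ->
      f x + dot (x - xs) (x - xs) + k%:R * penalty S x <=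
      f y + dot (y - xs) (y - xs) + k%:R * penalty S y].
Proof.
move=> r0 cont e0; case: (hS) => clC _ _ _ _.
have cont' x : `|x - xs| <= r ->
    {for x, continuous f} /\ {for x, continuous (penalty S)}.
  by move=> /cont[].
have /choice[x xP] := fun k => penalized_minimizer k r0 cont'.
have [U [UU Uoo]] := ultra_nat.
have [|xb xU] := @ultra_bounded_cvg R _ U UU (fun k => x k - xs + xs) (r + `|xs|).
  apply: nearW => k; have [_ xr _] := xP k.
  by rewrite (le_trans (ler_normD _ _))// lerD2r.
have {}xU : x @ U --> xb.
  by rewrite (_ : x = fun k => x k - xs + xs)//; apply/funext => k; rewrite subrK.
have xsU : x k - xs @[k --> U] --> xb - xs by exact: cvgB xU (cvg_cst _).
have xbr : `|xb - xs| <= r.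
  apply: (closed_cvg _ (@closed_le _ r) _ _ (cvg_norm xsU)).
  by apply: nearW => k; have [] := xP k.
have Cxb : prodC S xb.
  apply: (closed_cvg _ (closed_prod clC) _ _ xU).
  by apply: nearW => k; have [] := xP k.
have [fc pc xbmin] := cont xb xbr.
have fU : f (x k) @[k --> U] --> f xb by apply: continuous_cvg xU.
have pU : penalty S (x k) @[k --> U] --> penalty S xb by apply: continuous_cvg xU.
have dU := cvg_dot xsU xsU.
have Cxs : prodC S xs by case: FS.
have key k : f (x k) + dot (x k - xs) (x k - xs) + k%:R * penalty S (x k) <= f xs.
  have [_ _ /(_ xs Cxs)] := xP k; rewrite subrr normr0 => /(_ (ltW r0)).
  rewrite (feasible_penalty FS) mulr0 addr0 [dot 0 0]big1 ?addr0// => j _.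
  by rewrite mxE mul0r.
(* If the limit had positive penalty, [k%:R * penalty] would outgrow the bounded gap between [f xs]
   and the values [f (x k)]. *)
have pb0 : penalty S xb = 0.
  apply/eqP; rewrite eq_le penalty_ge0 andbT leNgt; apply/negP => pb.
  have pb2 : 0 < penalty S xb / 2 by rewrite divr_gt0.
  have [N Nbig] : exists N : nat, f xs - f xb + 1 < N%:R * (penalty S xb / 2).
    exists (Num.truncn ((f xs - f xb + 1) / (penalty S xb / 2))).+1.
    by rewrite -ltr_pdivrMr// truncnS_gt.
  have big : \forall k \near U, (N <= k)%N by apply: Uoo; exists N.
  have [k [[kp kf] Nk]] := filter_ex (filterI (filterI (cvg_near_dist pU pb2)
    (cvg_near_dist fU ltr01)) big).
  have h1 : penalty S xb / 2 <= penalty S (x k).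
    by move: kp; rewrite ltr_norml => /andP[+ _]; lra.
  have h2 : f xb - 1 < f (x k).
    by move: kf; rewrite ltr_norml => /andP[+ _]; lra.
  have h3 : N%:R * (penalty S xb / 2) <= k%:R * penalty S (x k).
    by rewrite ler_pM// ?ler_nat// ltW.
  have := key k; have := dot_ge0 (x k - xs); lra.
have Fxb := penalty_eq0 pb0 Cxb.
have : f xb + dot (xb - xs) (xb - xs) <= f xs.
  have fdU : f (x k) + dot (x k - xs) (x k - xs) @[k --> U] -->
      f xb + dot (xb - xs) (xb - xs) by apply: cvgD; [exact: fU|exact: dU].
  apply: (closed_cvg _ (@closed_le _ (f xs)) _ _ fdU).
  apply: nearW => k; apply: le_trans (key k).
  by rewrite lerDl mulr_ge0// penalty_ge0.
have := xbmin Fxb; have := sqr_norm_le_dot (xb - xs) => d1 d2 d3.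
have /eqP : `|xb - xs| ^+ 2 = 0.
  by apply/eqP; rewrite eq_le sqr_ge0 andbT; lra.
rewrite sqrf_eq0 normr_eq0 subr_eq0 => /eqP xbE.
rewrite {}xbE in xU *.
have [k xk] := filter_ex (cvg_near_dist xU e0).
by have [Ck xr kmin] := xP k; exists (x k), k; split.
Qed.

(** The coefficient [s] is 1 for genuine multipliers and tends to 0 after normalization, so one
    notion serves both cases. The sign pattern refers to [xs], the generalized derivatives to
    [x]. *)
Definition approx_stationary (e s : R) x zeta v mu eta : Prop :=
  [/\ `|x - xs| < e,
      limiting_subdifferential f x zeta /\
      forall i, limiting_subdifferential (sys_g S i) x (v i),
      limiting_normal_cone (prodC S) x eta, signed_multiplier S xs mu
    & `|s *: zeta + \sum_t mu t *: constr_vec S v x t + eta| < e].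

Lemma feasible_index_cases i :
  [\/ i \in idxI S xs, i \in idxJ S xs | i \in idxK S xs].
Proof.
have [G0 H0 GH] := feasible_compl i FS.
have [Gi|Gi] := eqVneq (sys_Gi S i xs) 0.
  have [Hi|Hi] := eqVneq (sys_Hi S i xs) 0.
    by apply: Or32; rewrite inE Gi Hi eqxx.
  by apply: Or31; rewrite inE Gi eqxx lt_neqAle eq_sym Hi.
apply: Or33; rewrite inE lt_neqAle eq_sym Gi G0 /=.
by move/eqP: GH; rewrite mulf_eq0 (negPf Gi).
Qed.

Lemma approx_multipliers e : 0 < e -> exists x zeta v mu eta,
  approx_stationary e 1 x zeta v mu eta /\ (x = xs -> forall t, mu t = 0).
Proof.
move=> e0; have [r0 r00 reg] := local_region.
pose r := r0 / 2; have r_gt0 : 0 < r by rewrite divr_gt0.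
have rlt : r < r0 by rewrite /r ltr_pdivrMr// mulr_natr mulr2n ltrDl.
(* Distance below [r] makes [x] interior to the ball, so all nearby [y] in [C] are competitors.
   Distance below [e / 8] keeps the proximal gradient [2 *: (x - xs)] under [e / 4], on top of the
   error [e / 2] of the multiplier rule. *)
have [||x [k [Cx xe xr xmin]]] := @penalized_minimizer_near r
    (Num.min r (e / 8)) r_gt0.
- move=> x xr; have [[L fL] gL sd fm _] := reg x (le_lt_trans xr rlt).
  split=> //; first exact: lip_near_continuous fL.
  apply: penalty_cvg => [i|t]; last exact: differentiable_continuous.
  by have [L' gi] := gL i; exact: lip_near_continuous gi.
- by rewrite lt_min r_gt0 divr_gt0.
move: xe; rewrite lt_min => /andP[xltr xe].
have [fL gL sd _ [gneg GI HK]] := reg x (le_lt_trans xr rlt).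
case: (hS) => clC _ _ _ _.
pose mu t := k%:R * (2 * residual S x t).
(* The single constant [k%:R + 1] dominates both the factor [k] of the squared increments and the
   factor 1 of the proximal remainder. *)
have [|||zeta [v [eta [fz gv Neta res]]]] := @penalized_multipliers R _ n
   (smooth_index m p) f (sys_g S) (smooth_constr S) (prodC S) x (2 *: (x - xs))
   (fun i => mu (inl i)) (fun t => mu (inr t)) (k%:R + 1) (e / 2)
   (closed_prod clC) Cx fL gL sd.
- by move=> i; rewrite /mu !mulr_ge0//= le_max lexx orbT.
- apply/near_norm; exists (r - `|x - xs|) => [|y]; first by rewrite subr_gt0.
  rewrite ltrBrDr => yr Cy.
  have {}yr : `|y - xs| <= r.
    by rewrite ltW// (le_lt_trans _ yr)// ler_distD.
  have := xmin y Cy yr.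
  have := ler_wpM2l (ler0n R k) (penalty_le S x y).
  have dE : dot (y - xs) (y - xs) = dot (x - xs) (x - xs)
      + dot (2 *: (x - xs)) (y - x) + dot (y - x) (y - x).
    have -> : y - xs = (x - xs) + (y - x) by rewrite [RHS]addrC subrKA.
    by rewrite dot_sqrD dotZl.
  rewrite dE; have := dot_ge0 (y - x).
  move: (penalty S x) (penalty S y) (dot (y - x) (y - x)) (dot (x - xs) (x - xs))
    (dot (2 *: (x - xs)) (y - x)) => px py D D0 D1 Dge0.
  rewrite !mulrDr !mulr_sumr.
  have E1 : \sum_i k%:R * (2 * residual S x (inl i) * (sys_g S i y - sys_g S i x))
    = \sum_i mu (inl i) * (sys_g S i y - sys_g S i x).
    by apply: eq_bigr => i _; rewrite /mu mulrA.
  have E2 : \sum_t k%:R * (2 * residual S x (inr t) *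
      (smooth_constr S t y - smooth_constr S t x))
    = \sum_t mu (inr t) * (smooth_constr S t y - smooth_constr S t x).
    by apply: eq_bigr => i _; rewrite /mu mulrA.
  rewrite E1 E2.
  have le1 (I : finType) (F : I -> R) :
      \sum_i k%:R * F i ^+ 2 <= \sum_i (k%:R + 1) * F i ^+ 2.
    by apply: ler_sum => i _; rewrite ler_wpM2r ?sqr_ge0// lerDl.
  have := le1 _ (fun i => sys_g S i y - sys_g S i x).
  have := le1 _ (fun t => smooth_constr S t y - smooth_constr S t x).
  have : D <= (k%:R + 1) * D by rewrite ler_peMl// lerDr.
  lra.
- by rewrite divr_gt0.
exists x, zeta, v, mu, eta; split; last first.
  by move=> xE t; rewrite /mu feasible_residual ?mulr0// xE.
split=> //.
- by rewrite (lt_le_trans xe)//; lra.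
- split.
  + by move=> i; rewrite /mu !mulr_ge0//= le_max lexx orbT.
  + move=> i; rewrite inE /mu /= => gi; rewrite max_r ?mulr0//.
    by have [g0 _ _ _] := FS; apply/ltW/gneg; rewrite lt_neqAle gi g0.
  + move=> i; rewrite inE negb_or => /andP[iI iJ]; rewrite /mu /=.
    case: (feasible_index_cases i) => iK; try by rewrite iK in iI iJ.
    by rewrite compl_resG_eq0 ?mulr0// HK.
  + move=> i; rewrite inE negb_or => /andP[iK iJ]; rewrite /mu /=.
    case: (feasible_index_cases i) => iI; try by rewrite iI in iK iJ.
    by rewrite compl_resH_eq0 ?mulr0// GI.
  + move=> i _; rewrite /mu /=; have [->|k0] := posnP k.
      by right; rewrite !mul0r.
    have k0' : 0 < k%:R * 2 :> R by rewrite mulr_gt0// ltr0n.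
    case: (compl_res_sign (sys_Gi S i x) (sys_Hi S i x)) => [[h1 h2]|h].
      by left; rewrite !mulrA !pmulr_rlt0.
    by right; rewrite mulrACA [X in _ * X]mulrACA h !mulr0.
- rewrite scale1r big_sumType /= addrA.
  set a := (X in `|X|); set b := (X in `|X| <= _) in res.
  have -> : a = b - 2 *: (x - xs).
    by rewrite /a /b; apply/rowP => j; rewrite !mxE; ring.
  rewrite (le_lt_trans (ler_normB _ _))// normrZ ger0_norm//; lra.
Qed.

End Penalization.

(** * Limits of approximate multipliers *)

Lemma cvg_norm_unique (R : realType) (V : normedModType R) (T : Type)
    (F : set_system T) {FF : ProperFilter F} (u : T -> V) (a b : V) :
  u @ F --> a -> u @ F --> b -> a = b.
Proof. by move=> ua ub; exact: (cvg_unique (@norm_hausdorff _ V) ua ub). Qed.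

Lemma cvg_eventually_eq (R : realType) (V : normedModType R) (T : Type)
    (F : set_system T) {FF : ProperFilter F} (u : T -> V) (a b : V) :
  u @ F --> a -> (\forall t \near F, u t = b) -> a = b.
Proof.
move=> ua ub; apply: (cvg_norm_unique ua) => B Bb.
by apply: filterS ub => t /= ->; exact: nbhs_singleton.
Qed.

(** The open quadrant is not closed, but its union with the two axes is: the points added by closing
    the quadrant lie on the axes. *)
Lemma ultra_sign_closed (R : realType) (U : set_system nat) (UU : UltraFilter U)
    (u w : nat -> R) (a b : R) :
  u @ U --> a -> w @ U --> b ->
  (forall k, (u k < 0 /\ w k < 0) \/ u k * w k = 0) ->
  (a < 0 /\ b < 0) \/ a * b = 0.
Proof.
move=> ua wb H; have [|nz] := eqVneq (a * b) 0; first by right.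
left; have [U0|Un0] := in_ultra_setVsetC [set k | u k * w k = 0] UU.
  have uwab : u k * w k @[k --> U] --> a * b by apply: cvgM; [exact: ua|exact: wb].
  by rewrite (cvg_eventually_eq uwab U0) eqxx in nz.
have le0 : a <= 0 /\ b <= 0.
  split.
    apply: (closed_cvg _ (@closed_le _ 0) _ _ ua).
    by apply: filterS Un0 => k; have [[/ltW]|] := H k.
  apply: (closed_cvg _ (@closed_le _ 0) _ _ wb).
  by apply: filterS Un0 => k; have [[_ /ltW]|] := H k.
move: nz le0; rewrite mulf_eq0 negb_or => /andP[a0 b0] [a1 b1].
by rewrite !lt_neqAle a0 b0.
Qed.

(** Serves to freeze the support of the multipliers along the ultrafilter. *)
Lemma ultra_finite_const (T : finType) (U : set_system nat) (UU : UltraFilter U)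
  (A : nat -> T) : exists a, \forall k \near U, A k = a.
Proof.
apply: contrapT => H.
have : \forall k \near U, forall a, A k <> a.
  apply: filter_forall => a.
  have [U1|//] := in_ultra_setVsetC [set k | A k = a] UU.
  by exfalso; apply: H; exists a.
by move=> /filter_ex[k /(_ (A k))].
Qed.

Section Limits.
Variables (R : realType) (n m p l : nat) (q : 'I_l -> nat).
Variables (S : csystem R n m p q).
Local Notation Rd := 'rV[R]_(\sum_i q i).
Variables (f : Rd -> R) (xs : Rd).
Hypotheses (hS : standing_assumptions S xs) (hf : lipschitz_around f xs)
  (Fxs : feasible S xs).

Lemma gradient_smooth_continuous (t : smooth_index m p) :
  {for xs, continuous (gradient (smooth_constr S t))}.
Proof.
case: hS => _ _ hC GC HC.
have at_xs (u : Rd -> R) : C1_around u xs -> {for xs, continuous (gradient u)}.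
  by move=> /near_norm[e e0] /(_ xs); rewrite subrr normr0 => /(_ e0)[].
case: t => [i|[i|i]].
- exact: (at_xs _ (hC i)).
- exact: (at_xs _ (GC i)).
- exact: (at_xs _ (HC i)).
Qed.

Variables (x_ : nat -> Rd) (s_ : nat -> R) (zeta_ : nat -> Rd)
  (v_ : nat -> 'I_n -> Rd) (mu_ : nat -> constr_index n m p -> R) (eta_ : nat -> Rd).
Variable M : R.
Hypothesis approx : forall k, approx_stationary S f xs k.+1%:R^-1 (s_ k) (x_ k)
  (zeta_ k) (v_ k) (mu_ k) (eta_ k).
Hypothesis sM : forall k, `|s_ k| <= M.
Hypothesis muM : forall k t, `|mu_ k t| <= M.
Variable U : set_system nat.
Hypothesis (UU : UltraFilter U) (Uoo : \oo `<=` U).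

Lemma ultra_subdifferential_cvg (u : Rd -> R) (z_ : nat -> Rd) :
  lipschitz_around u xs ->
  (forall k, limiting_subdifferential u (x_ k) (z_ k)) ->
  exists2 z, limiting_subdifferential u xs z & z_ @ U --> z.
Proof.
move=> uL zP; have xU : x_ @ U --> xs.
  have xoo : x_ @ \oo --> xs by apply: cvg_inv_succ => k; have [] := approx k.
  by move=> B /xoo; exact: Uoo.
have [L L0 uLx] := lipschitz_around_near uL.
have [e e0 eL] := lip_near_shift uLx.
have [|z zU] := @ultra_bounded_cvg R _ U UU z_ L.
  apply: filterS (cvg_near_dist xU e0) => k xk.
  exact: limiting_subdifferential_le_lip L0 (eL _ xk) (zP k).
exists z => //; apply: limiting_subdifferential_closed => [|t t0].
  exact: lip_near_continuous uLx.
have [k [xk zk]] := filter_ex (filterI (cvg_near_dist xU t0) (cvg_near_dist zU t0)).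
by exists (x_ k), (z_ k).
Qed.

(** Common to the bounded case ([s_ = 1]) and the normalized one ([s_] tending to 0). Local
    Lipschitz constants bound the subgradients and [M] bounds the coefficients. *)
Lemma stationary_limit : exists s zeta v mu eta,
  [/\ limiting_subdifferential f xs zeta,
      forall i, limiting_subdifferential (sys_g S i) xs (v i),
      limiting_normal_cone (prodC S) xs eta, signed_multiplier S xs mu
    & s *: zeta + \sum_t mu t *: constr_vec S v xs t + eta = 0] /\
  [/\ s_ @ U --> s, forall i, v_ k i @[k --> U] --> v i,
      forall t, mu_ k t @[k --> U] --> mu t, x_ @ U --> xs & eta_ @ U --> eta].
Proof.
have xU : x_ @ U --> xs.
  have xoo : x_ @ \oo --> xs by apply: cvg_inv_succ => k; have [] := approx k.
  by move=> B /xoo; exact: Uoo.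
have [zeta fz zU] : exists2 z, limiting_subdifferential f xs z & zeta_ @ U --> z.
  apply: ultra_subdifferential_cvg => // k.
  by have [_ []] := approx k.
have /choice[v vP] : forall i, exists w, limiting_subdifferential (sys_g S i) xs w /\
    v_ k i @[k --> U] --> w.
  move=> i; case: hS => _ gL _ _ _.
  have [|w gw wU] := @ultra_subdifferential_cvg (sys_g S i) (fun k => v_ k i) (gL i).
    by move=> k; have [_ []] := approx k.
  by exists w.
have [|s sU] := @ultra_bounded_cvg_real R U UU s_ M; first exact: nearW.
have /choice[mu muU] : forall t, exists a : R, mu_ k t @[k --> U] --> a.
  by move=> t; apply: (@ultra_bounded_cvg_real R U UU _ M); apply: nearW => k.
pose sum_ k := s_ k *: zeta_ k + \sum_t mu_ k t *: constr_vec S (v_ k) (x_ k) t.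
pose sum := s *: zeta + \sum_t mu t *: constr_vec S v xs t.
have sumU : sum_ @ U --> sum.
  apply: cvgD; first by apply: cvgZ; [exact: sU|exact: zU].
  apply: cvg_sumr => t _; apply: cvgZ; first exact: muU.
  case: t => [i|t] /=; first by have [] := vP i.
  apply: (@continuous_cvg _ _ _ U _ x_ (gradient (smooth_constr S t))) => //.
  exact: gradient_smooth_continuous.
have resU : sum_ k + eta_ k @[k --> U] --> (0 : Rd).
  have resoo : sum_ k + eta_ k @[k --> \oo] --> (0 : Rd).
    by apply: cvg_inv_succ => k; rewrite subr0; have [] := approx k.
  by move=> B /resoo; exact: Uoo.
(* No bound on the normals is assumed; the vanishing residual transfers the convergence of the other
   terms to them. *)
have etaU : eta_ @ U --> - sum.
  rewrite (_ : eta_ = fun k => (sum_ k + eta_ k) - sum_ k); last first.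
    by apply/funext => k; rewrite addrC addKr.
  by rewrite -[- sum]add0r; apply: cvgB; [exact: resU|exact: sumU].
exists s, zeta, v, mu, (- sum); split; last by split=> // i; have [] := vP i.
split=> //; [by move=> i; have [] := vP i| | |exact: subrr].
- apply: limiting_normal_cone_closed => [|e e0]; first by case: Fxs.
  have [k [xk ek]] := filter_ex (filterI (cvg_near_dist xU e0)
    (cvg_near_dist etaU e0)).
  by exists (x_ k), (eta_ k); split=> //; have [] := approx k.
have zero t : (forall k, mu_ k t = 0) -> mu t = 0.
  by move=> mu0; apply: (cvg_eventually_eq (muU t)); apply: nearW => k; exact: mu0.
split.
- move=> i; apply: (closed_cvg _ (@closed_ge _ 0) _ _ (muU (inl i))).
  by apply: nearW => k; have [_ _ _ [H _ _ _ _] _] := approx k; exact: H.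
- by move=> i iI; apply: zero => k; have [_ _ _ [_ H _ _ _] _] := approx k; exact: H.
- by move=> i iI; apply: zero => k; have [_ _ _ [_ _ H _ _] _] := approx k; exact: H.
- by move=> i iI; apply: zero => k; have [_ _ _ [_ _ _ H _] _] := approx k; exact: H.
- move=> i iJ; apply: (ultra_sign_closed UU (muU _) (muU _)) => k.
  by have [_ _ _ [_ _ _ _ H] _] := approx k; exact: H.
Qed.

End Limits.

(** * Reduction of multipliers *)

Section Reduction.
Variables (R : realType) (n m p l : nat) (q : 'I_l -> nat).
Variables (S : csystem R n m p q).
Local Notation Rd := 'rV[R]_(\sum_i q i).
Implicit Types (x y z zeta eta : Rd) (v : 'I_n -> Rd).

Definition smooth_grad y (t : smooth_index m p) : Rd := gradient (smooth_constr S t) y.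

Definition smooth_seq (I1 : {set 'I_m}) (I2 I3 : {set 'I_p}) : seq (smooth_index m p) :=
  [seq inl i | i <- enum I1] ++
  [seq inr (inl i) | i <- enum I2] ++ [seq inr (inr i) | i <- enum I3].

Lemma smooth_familyE I1 I2 I3 y :
  smooth_family S I1 I2 I3 y = map (smooth_grad y) (smooth_seq I1 I2 I3).
Proof. by rewrite /smooth_family /smooth_seq !map_cat -!map_comp. Qed.

Lemma mem_smooth_seq I1 I2 I3 t : (t \in smooth_seq I1 I2 I3) =
  match t with
  | inl i => i \in I1 | inr (inl i) => i \in I2 | inr (inr i) => i \in I3
  end.
Proof.
rewrite !mem_cat; apply/or3P/idP => [[] /mapP[i + ->]|]; try by rewrite mem_enum.
case: t => [i|[i|i]] iI.
- by apply: Or31; apply/mapP; exists i; rewrite ?mem_enum.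
- by apply: Or32; apply/mapP; exists i; rewrite ?mem_enum.
- by apply: Or33; apply/mapP; exists i; rewrite ?mem_enum.
Qed.

Lemma uniq_smooth_seq I1 I2 I3 : uniq (smooth_seq I1 I2 I3).
Proof.
rewrite !cat_uniq !map_inj_uniq ?enum_uniq//=; try by move=> a b [].
rewrite andbT; apply/andP; split; apply/hasPn => t.
  by rewrite mem_cat => /orP[] /mapP[i _ ->]; apply/mapP => -[].
by move=> /mapP[i _ ->]; apply/mapP => -[].
Qed.

Definition fam_index : finType := (constr_index n m p + 'I_l)%type.

Definition fam_vec v x eta (t : fam_index) : Rd :=
  match t with
  | inl t => constr_vec S v x t
  | inr i => only_block eta i
  end.

Lemma sum_only_block (b : 'I_l -> R) eta :
  \sum_i b i *: only_block eta i = \mxrow_i (b i *: submxrow eta i).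
Proof.
apply/mxrowP => j; rewrite submxrow_sum mxrowK (bigD1 j)//= [X in _ + X]big1 => [|i ij].
  by rewrite submxrowZ mxrowK eqxx addr0.
by rewrite submxrowZ mxrowK eq_sym (negPf ij) scaler0.
Qed.

Lemma only_block_scale (b : 'I_l -> R) eta i :
  only_block (\mxrow_j (b j *: submxrow eta j)) i = b i *: only_block eta i.
Proof.
apply/mxrowP => j; rewrite submxrowZ !mxrowK.
by case: eqP => [->|_]; rewrite ?mxrowK// scaler0.
Qed.

Lemma lin_indep_inl_inr v x eta (s : seq (smooth_index m p)) : uniq s ->
  lin_indep (smooth_grad x) [set t in s]%SET ->
  lin_indep (fam_vec v x eta) [set t in [seq inl (inr t) | t <- s]]%SET.
Proof.
move=> us /(free_mapP _ us) fs.
have us2 : uniq [seq (inl (inr t) : fam_index) | t <- s].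
  by rewrite map_inj_uniq// => a b [].
by apply/(free_mapP _ us2); rewrite -map_comp.
Qed.

Variables (f : Rd -> R) (xs : Rd).

Definition equality_seq : seq (smooth_index m p) :=
  smooth_seq [set: 'I_m]%SET (idxI S xs) (idxK S xs).

(** The basis is included even where its multipliers vanish, because the family tested in (ii) of
    RCPLD contains all basis gradients. *)
Definition fam_support (s : seq (smooth_index m p)) (mu : constr_index n m p -> R)
    eta : {set fam_index} :=
  ([set t in [seq inl (inr t) | t <- s]] :|:
   [set t : fam_index | match t with inl t => mu t != 0
                        | inr i => submxrow eta i != 0 end])%SET.

(** The equality-type gradients are first rewritten over [s'], then the signed reduction runs with
    [s'] protected. Signs may be lost on [s'] only, where none is prescribed. *)
Lemma reduce_multipliers (s' : seq (smooth_index m p)) y (e s : R) zeta v mu eta :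
  subseq s' equality_seq -> lin_indep (smooth_grad y) [set t in s']%SET ->
  <<map (smooth_grad y) s'>>%VS = <<map (smooth_grad y) equality_seq>>%VS ->
  approx_stationary S f xs e s y zeta v mu eta ->
  exists mu' eta', [/\ approx_stationary S f xs e s y zeta v mu' eta',
    forall t, t \in equality_seq -> t \notin s' -> mu' (inr t) = 0
  & lin_indep (fam_vec v y eta') (fam_support s' mu' eta')].
Proof.
move=> s'sub li spanE [yx sub Neta sign res].
have us : uniq equality_seq by exact: uniq_smooth_seq.
have us' : uniq s' := subseq_uniq s'sub us.
have s's := mem_subseq s'sub.
have [c cE] : exists c : smooth_index m p -> R,
    \sum_(t <- equality_seq) mu (inr t) *: smooth_grad y t =
    \sum_(t <- s') c t *: smooth_grad y t.
  by apply: span_mapP => //; rewrite spanE; exact: sum_map_span.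
(* Each block of [eta] starts with coefficient 1, so preservation of signs gives it a nonnegative
   factor. *)
pose al (t : fam_index) : R := match t with
  | inl (inl i) => mu (inl i)
  | inl (inr t) => if t \in s' then c t
                   else if t \in equality_seq then 0 else mu (inr t)
  | inr i => 1 end.
pose B := [set t : fam_index in [seq inl (inr t) | t <- s']]%SET.
have BE t : (inl (inr t) \in B) = (t \in s').
  by rewrite inE mem_map// => a b [].
have Bg i : inl (inl i) \in B = false by rewrite inE; apply/mapP => -[].
have Bb i : inr i \in B = false by rewrite inE; apply/mapP => -[].
have [b [bE bsgn bli]] := signed_caratheodory al
  (@lin_indep_inl_inr v y eta s' us' li).
have smoothE : \sum_t al (inl (inr t)) *: smooth_grad y t =
    \sum_t mu (inr t) *: smooth_grad y t.
  rewrite (bigID (mem equality_seq)) /= [RHS](bigID (mem equality_seq)) /=.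
  congr (_ + _); last first.
    apply: eq_bigr => t ts; rewrite /al (negPf ts) ifN//.
    by apply: contra ts => /s's.
  rewrite -!big_uniq// cE (bigID (mem s')) /= [X in _ + X]big1_seq ?addr0.
    rewrite -[LHS]big_filter; have -> : [seq t <- equality_seq | t \in s'] = s'.
      by apply/esym/(subseq_uniqP us).
    by apply: eq_big_seq => t ts; rewrite /al ts.
  by move=> t /andP[/negPf ts tA]; rewrite /al ts tA scale0r.
pose mu' t := b (inl t).
pose eta' : Rd := \mxrow_i (b (inr i) *: submxrow eta i).
have sumE : \sum_t mu' t *: constr_vec S v y t + eta' =
    \sum_t mu t *: constr_vec S v y t + eta.
  have etaE : eta = \sum_i 1 *: only_block eta i.
    rewrite sum_only_block -[LHS]submxrowK; apply: eq_mxrow => i.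
    by rewrite scale1r.
  transitivity (\sum_t b t *: fam_vec v y eta t).
    by rewrite [RHS]big_sumType /= (sum_only_block (fun i => b (inr i))).
  rewrite bE [X in _ = _ + X]etaE [LHS]big_sumType /=; congr (_ + _).
  by rewrite [LHS]big_sumType [RHS]big_sumType /=; congr (_ + _).
exists mu', eta'; split.
- split=> //; last by rewrite -addrA sumE addrA.
    apply: limiting_normal_cone_block_scale => // i.
    have := bsgn (inr i); rewrite Bb => /(_ isT)[->//|].
    by rewrite mul1r => /ltW.
  case: sign => mu0 muI muG muH muJ.
  have outG i : i \notin idxI S xs -> (inl (inr (inr (inl i))) \notin B) *
      (al (inl (inr (inr (inl i)))) = mu (inr (inr (inl i)))).
    move=> iI; have iA : inr (inl i) \notin equality_seq by rewrite mem_smooth_seq.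
    have is' : inr (inl i) \notin s' by apply: contra iA => /s's.
    by rewrite BE /al (negPf iA) (negPf is').
  have outH i : i \notin idxK S xs -> (inl (inr (inr (inr i))) \notin B) *
      (al (inl (inr (inr (inr i)))) = mu (inr (inr (inr i)))).
    move=> iI; have iA : inr (inr i) \notin equality_seq by rewrite mem_smooth_seq.
    have is' : inr (inr i) \notin s' by apply: contra iA => /s's.
    by rewrite BE /al (negPf iA) (negPf is').
  have zero t : t \notin B -> al t = 0 -> b t = 0.
    by move=> tB al0; case: (bsgn t tB) => //; rewrite al0 mul0r ltxx.
  split.
  + move=> i; have := bsgn (inl (inl i)); rewrite Bg => /(_ isT)[|/=].
      by rewrite /mu' => ->.
    by rewrite /mu'; have := mu0 i; nra.
  + by move=> i iI; apply: zero; rewrite ?Bg//= muI.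
  + move=> i iIJ; have iI : i \notin idxI S xs.
      by apply: contra iIJ => h; rewrite finset.in_setU h.
    by apply: zero; rewrite outG// muG.
  + move=> i iKJ; have iK : i \notin idxK S xs.
      by apply: contra iKJ => h; rewrite finset.in_setU h.
    by apply: zero; rewrite outH// muH.
  (* Biactive indices are not of equality type, so both of their coefficients keep their sign or
     vanish, which preserves the pattern. *)
  + move=> i iJ; have [iI iK] : i \notin idxI S xs /\ i \notin idxK S xs.
      move: iJ; rewrite !inE => /andP[/eqP -> /eqP ->].
      by rewrite !ltxx andbF.
    have [GB Gal] := outG i iI; have [HB Hal] := outH i iK.
    have sG := bsgn _ GB; have sH := bsgn _ HB; rewrite Gal in sG; rewrite Hal in sH.
    rewrite /mu'; case: (muJ i iJ) => [[G0 H0]|/eqP].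
      case: sG => [->|sG]; first by right; rewrite mul0r.
      case: sH => [->|sH]; first by right; rewrite mulr0.
      by left; rewrite !nmulr_rgt0 in sG sH *.
    rewrite mulf_eq0 => /orP[] /eqP m0.
      by right; rewrite (zero _ GB) ?mul0r// Gal.
    by right; rewrite (zero _ HB) ?mulr0// Hal.
- move=> t tA ts'; have tB : inl (inr t) \notin B by rewrite BE.
  case: (bsgn _ tB) => //; by rewrite /al (negPf ts') tA mul0r ltxx.
rewrite /fam_support -/B; set D := (_ :|: _)%SET.
(* The reduction gives independence of the original blocks of [eta]; those of [eta'] differ from
   them by factors that are nonzero on the support. *)
pose a (t : fam_index) := match t with inl t => 1 | inr i => b (inr i) end.
have DE i : inr i \in D -> b (inr i) != 0.
  rewrite inE Bb /= inE; apply: contra_neq => b0.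
  by rewrite mxrowK b0 scale0r.
have DB : D \subset (B :|: [set t | b t != 0])%SET.
  apply/fintype.subsetP => -[t|i] tD; last first.
    by rewrite finset.in_setU; apply/orP; right; rewrite inE; exact: DE.
  by move: tD; rewrite !inE.
have a0 t : t \in D -> a t != 0.
  by case: t => [t|i] tD; [exact: oner_neq0|exact: DE].
have := lin_indep_scale a0 (lin_indep_sub DB bli); apply: eq_lin_indep.
move=> [t|i] tD; first by rewrite /= scale1r.
by rewrite /= only_block_scale.
Qed.

End Reduction.

(** * M-stationarity *)

Lemma sum_scale_support (R : realType) (V : lmodType R) (T : finType) (A : {set T})
    (c : T -> R) (w : T -> V) :
  (forall t, t \notin A -> c t = 0) ->
  \sum_t c t *: w t = \sum_(t in A) c t *: w t.
Proof.
move=> cA; rewrite [RHS]big_mkcond; apply: eq_bigr => t _.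
by case: ifP => // /negbT/cA ->; rewrite scale0r.
Qed.

Section Multipliers.
Variables (R : realType) (n m p l : nat) (q : 'I_l -> nat).
Variables (S : csystem R n m p q).
Local Notation Rd := 'rV[R]_(\sum_i q i).
Implicit Types (x y z zeta eta : Rd) (v : 'I_n -> Rd) (mu : constr_index n m p -> R).

Lemma multiplier_sum v x mu (I4 : {set 'I_n}) (I1 : {set 'I_m}) (J2 J3 : {set 'I_p}) :
  (forall i, i \notin I4 -> mu (inl i) = 0) ->
  (forall i, i \notin I1 -> mu (inr (inl i)) = 0) ->
  (forall i, i \notin J2 -> mu (inr (inr (inl i))) = 0) ->
  (forall i, i \notin J3 -> mu (inr (inr (inr i))) = 0) ->
  \sum_t mu t *: constr_vec S v x t =
    \sum_(i in I4) (\row_i mu (inl i)) 0 i *: v i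
    + \sum_(i in I1) (\row_i mu (inr (inl i))) 0 i *: gradient (sys_h S i) x
    - \sum_(i in J2) (\row_i - mu (inr (inr (inl i)))) 0 i *: gradient (sys_Gi S i) x
    - \sum_(i in J3) (\row_i - mu (inr (inr (inr i)))) 0 i *: gradient (sys_Hi S i) x.
Proof.
move=> h4 h1 h2 h3; rewrite [LHS]big_sumType /= -!addrA; congr (_ + _).
  rewrite (sum_scale_support _ h4); apply: eq_bigr => i _.
  by rewrite mxE.
rewrite [LHS]big_sumType /=; congr (_ + _).
  rewrite (sum_scale_support _ h1); apply: eq_bigr => i _.
  by rewrite mxE.
rewrite [LHS]big_sumType /= -!sumrN; congr (_ + _).
  rewrite (sum_scale_support _ h2); apply: eq_bigr => i _.
  by rewrite mxE scaleNr opprK.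
rewrite (sum_scale_support _ h3); apply: eq_bigr => i _.
by rewrite mxE scaleNr opprK.
Qed.

Lemma signed_multiplier_M_sign xs mu i : signed_multiplier S xs mu ->
  i \in idxJ S xs ->
  M_sign (\row_i - mu (inr (inr (inl i)))) (\row_i - mu (inr (inr (inr i)))) i.
Proof.
move=> [_ _ _ _ /(_ i) H] /H; rewrite /M_sign !mxE !oppr_gt0 mulrNN.
by [].
Qed.

Variables (f : Rd -> R) (xs : Rd).
Hypotheses (hS : standing_assumptions S xs) (hf : lipschitz_around f xs)
  (hmin : local_minimizer f (feasible S) xs).

Let Fxs : feasible S xs. Proof. by case: hmin. Qed.

Lemma bounded_multipliers_M_stationary (M : R) :
  (forall e : R, 0 < e -> exists x zeta v mu eta,
     approx_stationary S f xs e 1 x zeta v mu eta /\ forall t, `|mu t| <= M) ->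
  M_stationary S f xs.
Proof.
move=> H; have /choice[D DP] : forall k : nat, exists D : Rd * Rd * ('I_n -> Rd)
      * (constr_index n m p -> R) * Rd,
    let: (x, zeta, v, mu, eta) := D in
    approx_stationary S f xs k.+1%:R^-1 1 x zeta v mu eta /\
    forall t, `|mu t| <= M.
  move=> k; have [|x [zeta [v [mu [eta Hk]]]]] := H k.+1%:R^-1.
    by rewrite invr_gt0.
  by exists (x, zeta, v, mu, eta).
have [U [UU Uoo]] := ultra_nat.
(* The bound [|M| + 1] must dominate the constant coefficient 1 of the objective as well as the
   multipliers. *)
have [|||s [zeta [v [mu [eta [[fz gv Neta sgn sum0] [s1 _ _ _ _]]]]]]] :=
  @stationary_limit R n m p l q S f xs hS hf Fxs (fun k => (D k).1.1.1.1) (fun=> 1)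
    (fun k => (D k).1.1.1.2) (fun k => (D k).1.1.2) (fun k => (D k).1.2)
    (fun k => (D k).2) (`|M| + 1) _ _ _ U UU Uoo.
- by move=> k; have := DP k; case: (D k) => [[[[]]]] ? ? ? ? ? [].
- by move=> k; rewrite normr1 lerDr.
- move=> k t; have := DP k; case: (D k) => [[[[]]]] ? ? ? ? ? [_ /(_ t)] /= h.
  by rewrite (le_trans h)// (le_trans (ler_norm _))// lerDl.
have {s1} s1 : s = 1 by apply: (cvg_eventually_eq s1); exact: nearW.
case: (sgn) => mu0 muI muG muH _.
exists (\row_i mu (inl i)), (\row_i mu (inr (inl i))),
  (\row_i - mu (inr (inr (inl i)))), (\row_i - mu (inr (inr (inr i)))); split.
- by move=> i _; rewrite mxE.
- exists zeta, v, eta; split=> //.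
  rewrite -[LHS]sum0 s1 scale1r.
  rewrite (@multiplier_sum _ _ _ (activeg S xs) [set: 'I_m]%SET
    (idxI S xs :|: idxJ S xs)%SET (idxK S xs :|: idxJ S xs)%SET) //.
    rewrite !addrA; congr (_ + _ + _ - _ - _ + _).
    by apply: eq_bigl => i; rewrite inE.
  by move=> i; rewrite inE.
- move=> i iI; rewrite mxE muH ?oppr0//; move: iI; rewrite !inE.
  by move=> /andP[/eqP -> h]; rewrite ltxx (gt_eqF h) !andbF.
- move=> i iK; rewrite mxE muG ?oppr0//; move: iK; rewrite !inE.
  by move=> /andP[h _]; rewrite (gt_eqF h).
- by move=> i iJ; exact: signed_multiplier_M_sign sgn iJ.
Qed.

(** With [a <= 1] the residual does not grow, so the tolerance [e] is kept. *)
Lemma approx_stationary_scale (e s a : R) x zeta v mu eta : 0 < a <= 1 ->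
  approx_stationary S f xs e s x zeta v mu eta ->
  approx_stationary S f xs e (a * s) x zeta v (fun t => a * mu t) (a *: eta).
Proof.
move=> /andP[a0 a1] [xe sub Neta [mu0 muI muG muH muJ] res]; split=> //.
- rewrite (_ : a *: eta = \mxrow_i (a *: submxrow eta i)); last first.
    by apply/mxrowP => j; rewrite mxrowK submxrowZ.
  by apply: limiting_normal_cone_block_scale => // _; exact: ltW.
- split.
  + by move=> i; rewrite mulr_ge0// ltW.
  + by move=> i /muI ->; rewrite mulr0.
  + by move=> i /muG ->; rewrite mulr0.
  + by move=> i /muH ->; rewrite mulr0.
  + move=> i /muJ[[h1 h2]|h]; first by left; rewrite !pmulr_rlt0.
    by right; rewrite mulrACA h mulr0.
- have -> : \sum_t (a * mu t) *: constr_vec S v x t =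
      a *: \sum_t mu t *: constr_vec S v x t.
    by rewrite scaler_sumr; apply: eq_bigr => t _; rewrite scalerA.
  rewrite -scalerA -!scalerDr normrZ gtr0_norm// (le_lt_trans _ res)//.
  by rewrite ler_piMl.
Qed.

Lemma lin_indep_fam_scale (a : R) s v x mu eta : a != 0 ->
  lin_indep (fam_vec S v x eta) (fam_support s mu eta) ->
  lin_indep (fam_vec S v x (a *: eta)) (fam_support s (fun t => a * mu t) (a *: eta)).
Proof.
move=> a0 li.
have -> : fam_support s (fun t => a * mu t) (a *: eta) = fam_support s mu eta.
  apply/setP => -[t|i]; rewrite !inE; congr (_ || _).
    by rewrite mulf_eq0 (negPf a0).
  by rewrite submxrowZ scaler_eq0 (negPf a0).
pose b (t : fam_index n m p l) := match t with inl t => 1 | inr i => a end.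
have b0 t : t \in fam_support s mu eta -> b t != 0.
  by move=> _; case: t => [t|i] //=; exact: oner_neq0.
have := lin_indep_scale b0 li; apply: eq_lin_indep.
move=> [t|i] _ /=; first by rewrite scale1r.
rewrite -only_block_scale; congr only_block.
by apply/mxrowP => j; rewrite mxrowK submxrowZ.
Qed.

(** Independence of [s'] persists near [xs], and the constant rank of (i) then makes its span fill
    the whole span by equality of dimensions. *)
Lemma equality_basis_near (s' : seq (smooth_index m p)) :
  (\forall y \near xs,
     \dim <<smooth_family S [set: 'I_m]%SET (idxI S xs) (idxK S xs) y>> =
     \dim <<smooth_family S [set: 'I_m]%SET (idxI S xs) (idxK S xs) xs>>) ->
  subseq s' (equality_seq S xs) -> free (map (smooth_grad S xs) s') ->
  <<map (smooth_grad S xs) s'>>%VS = <<map (smooth_grad S xs) (equality_seq S xs)>>%VS ->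
  \forall y \near xs, lin_indep (smooth_grad S y) [set t in s']%SET /\
    <<map (smooth_grad S y) s'>>%VS = <<map (smooth_grad S y) (equality_seq S xs)>>%VS.
Proof.
move=> rk ss fs es.
have us' : uniq s' := subseq_uniq ss (uniq_smooth_seq _ _ _).
have li : \forall y \near xs, lin_indep (smooth_grad S y) [set t in s']%SET.
  apply: lin_indep_near; last exact/free_mapP.
  by move=> t _; exact: gradient_smooth_continuous.
apply: (@filterS _ (nbhs xs) (nbhs_filter xs) _ _ _
  (@filterI _ (nbhs xs) (nbhs_filter xs) _ _ rk li)) => y [dimy liy].
split=> //; apply/eqP; rewrite eqEdim; apply/andP; split.
  apply: sub_span => u /mapP[t ts ->]; apply: map_f.
  exact: (mem_subseq ss).
have /(free_mapP _ us') := liy; rewrite /free => /eqP ->.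
move: fs; rewrite /free es => /eqP; rewrite !size_map => <-.
by move: dimy; rewrite !smooth_familyE => ->.
Qed.

Hypothesis hR : RCPLD S xs.

Lemma unbounded_multipliers_absurd :
  (forall M : R, exists2 e : R, 0 < e & forall x zeta v mu eta,
     approx_stationary S f xs e 1 x zeta v mu eta -> exists t, M < `|mu t|) ->
  False.
Proof.
move=> H; case: hR => rk hRC.
have [s' [ss fs es]] := free_subseq (smooth_grad S xs) (equality_seq S xs).
have /near_norm[r r0 rP] := equality_basis_near rk ss fs es.
have us' : uniq s' := subseq_uniq ss (uniq_smooth_seq _ _ _).
have /choice[D DP] : forall k : nat, exists D : Rd * R * Rd * ('I_n -> Rd)
      * (constr_index n m p -> R) * Rd,
    let: (x, s, zeta, v, mu, eta) := D in
    [/\ approx_stationary S f xs k.+1%:R^-1 s x zeta v mu eta,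
        `|s| < k.+1%:R^-1, (forall t, `|mu t| <= 1) /\ 1 <= \sum_t `|mu t|,
        x != xs
      & (forall t, t \in equality_seq S xs -> t \notin s' -> mu (inr t) = 0) /\
        lin_indep (fam_vec S v x eta) (fam_support s' mu eta)].
  move=> k; have [e e0 eP] := H k.+1%:R.
  (* Three demands on the tolerance: [e] activates the hypothesis with bound [k.+1], the inverse of
     [k.+1] gives convergence, and [r] keeps [s'] a basis at [x]. *)
  have [|x [zeta [v [mu [eta [app xz]]]]]] :=
      approx_multipliers hS hf hmin (e := Num.min e (Num.min k.+1%:R^-1 r)).
    by rewrite !lt_min e0 r0 invr_gt0 ltr0n.
  have weaken (e1 e2 : R) mu1 eta1 : e1 <= e2 ->
      approx_stationary S f xs e1 1 x zeta v mu1 eta1 ->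
      approx_stationary S f xs e2 1 x zeta v mu1 eta1.
    move=> e12 [a1 a2 a3 a4 a5]; split=> //; exact: lt_le_trans e12.
  have le_e : Num.min e (Num.min k.+1%:R^-1 r) <= e by rewrite ge_min lexx.
  have le_k : Num.min e (Num.min k.+1%:R^-1 r) <= k.+1%:R^-1.
    by rewrite !ge_min lexx orbT.
  have xr : `|x - xs| < r.
    case: (app) => xr _ _ _ _; rewrite (lt_le_trans xr)//.
    by rewrite !ge_min lexx !orbT.
  have [liy spy] := rP x xr.
  have [mu' [eta' [app' supp li]]] := reduce_multipliers ss liy spy app.
  have [t1 mut1] := eP _ _ _ _ _ (weaken _ _ _ _ le_e app').
  (* The hypothesis is applied to the multipliers before reduction, since those are the ones known
     to vanish when [x = xs]. *)
  have xxs : x != xs.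
    apply/eqP => /xz mu0.
    have [t2] := eP _ _ _ _ _ (weaken _ _ _ _ le_e app).
    by rewrite mu0 normr0 ltrn0.
  case: (@arg_maxP _ _ _ t1 xpredT (fun t => `|mu' t|) isT) => t0 _ t0max.
  have Tk : k.+1%:R < `|mu' t0| := lt_le_trans mut1 (t0max t1 isT).
  have T0 : 0 < `|mu' t0| by rewrite (lt_trans _ Tk)// ltr0n.
  (* The largest multiplier becomes 1, so the limit is nonzero, while the coefficient of the
     objective becomes [a], below the inverse of [k.+1]. *)
  pose a := `|mu' t0|^-1.
  have a0 : 0 < a by rewrite invr_gt0.
  have ak : a < k.+1%:R^-1 by rewrite ltf_pV2 ?posrE// ltr0n.
  have a1 : a <= 1.
    rewrite (le_trans (ltW ak))// invf_le1 ?ltr0n// ler1n //.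
  exists (x, a, zeta, v, fun t => a * mu' t, a *: eta'); split=> //.
  - have a01 : 0 < a <= 1 by rewrite a0.
    by have := approx_stationary_scale a01 (weaken _ _ _ _ le_k app'); rewrite mulr1.
  - by rewrite gtr0_norm.
  - split=> [t|]; first by rewrite normrM gtr0_norm// ler_pdivrMl// mulr1; exact: t0max.
    rewrite (bigD1 t0)//= normrM gtr0_norm// mulVf ?gt_eqF// lerDl.
    by apply: sumr_ge0 => *; exact: normr_ge0.
  - split=> [t tA ts|]; first by rewrite supp// mulr0.
    by apply: lin_indep_fam_scale li; rewrite gt_eqF.
pose x_ k := (D k).1.1.1.1.1; pose s_ k := (D k).1.1.1.1.2.
pose zeta_ k := (D k).1.1.1.2; pose v_ k := (D k).1.1.2.
pose mu_ k := (D k).1.2; pose eta_ k := (D k).2.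
have P k : [/\ approx_stationary S f xs k.+1%:R^-1 (s_ k) (x_ k) (zeta_ k) (v_ k)
          (mu_ k) (eta_ k),
        `|s_ k| < k.+1%:R^-1, (forall t, `|mu_ k t| <= 1) /\ 1 <= \sum_t `|mu_ k t|,
        x_ k != xs
      & (forall t, t \in equality_seq S xs -> t \notin s' -> mu_ k (inr t) = 0) /\
        lin_indep (fam_vec S (v_ k) (x_ k) (eta_ k)) (fam_support s' (mu_ k) (eta_ k))].
  have := DP k; rewrite /x_ /s_ /zeta_ /v_ /mu_ /eta_.
  by case: (D k) => [[[[[]]]]].
have [U [UU Uoo]] := ultra_nat.
have [|||s [zeta [v [mu [eta [[fz gv Neta sgn sum0] [sU vU muU xU etaU]]]]]]] :=
  @stationary_limit R n m p l q S f xs hS hf Fxs x_ s_ zeta_ v_ mu_ eta_ 1 _ _ _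
    U UU Uoo.
- by move=> k; have [] := P k.
- move=> k; have [_ sk _ _ _] := P k.
  by rewrite (le_trans (ltW sk))// invf_le1 ?ltr0n// ler1n.
- by move=> k; have [_ _ []] := P k.
have s0 : s = 0.
  apply: (cvg_norm_unique sU) => B B0; apply: Uoo; move: B B0.
  by apply: cvg_inv_succ => k; rewrite subr0; have [] := P k.
have sum1 : 1 <= \sum_t `|mu t|.
  have F : \sum_t `|mu_ k t| @[k --> U] --> \sum_t `|mu t|.
    by apply: cvg_sumr => t _; apply: cvg_norm; exact: muU.
  apply: (closed_cvg _ (@closed_ge _ 1) _ _ F).
  by apply: nearW => k; have [_ _ []] := P k.
have [A UA] := ultra_finite_const UU (fun k => [set t | mu_ k t != 0]%SET).
have muA t : t \notin A -> mu t = 0.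
  move=> tA; apply: (cvg_eventually_eq (muU t)); apply: filterS UA => k Ak.
  by apply/eqP; move: tA; rewrite -Ak inE negbK.
(* RCPLD quantifies over ordinary sequences, so one is sampled from sets of the ultrafilter, with
   constant support [A]. The indices [kap j] need not increase. *)
have /choice[kap kapP] : forall j : nat, exists k : nat,
    [/\ [set t | mu_ k t != 0]%SET = A, `|x_ k - xs| < j.+1%:R^-1,
        `|eta_ k - eta| < j.+1%:R^-1
      & forall i, `|v_ k i - v i| < j.+1%:R^-1].
  move=> j; have j0 : 0 < j.+1%:R^-1 :> R by rewrite invr_gt0.
  have vall : \forall k \near U, forall i, `|v_ k i - v i| < j.+1%:R^-1.
    by apply: filter_forall => i; exact: cvg_near_dist (vU i) j0.
  have [k [[Ak xk] [ek vk]]] := filter_ex (filterI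
    (filterI UA (cvg_near_dist xU j0)) (filterI (cvg_near_dist etaU j0) vall)).
  by exists k.
case: (sgn) => mu0 muI muG muH muJ.
pose I1 := [set i | inl i \in s']%SET.
pose I2 := [set i | inr (inl i) \in s']%SET.
pose I3 := [set i | inr (inr i) \in s']%SET.
pose I4 := [set i | inl i \in A]%SET.
pose I5 := [set i in idxJ S xs | inr (inr (inl i)) \in A]%SET.
pose I6 := [set i in idxJ S xs | inr (inr (inr i)) \in A]%SET.
have mukA t : t \in A -> mu_ (kap 0%N) t != 0.
  by have [Ak _ _ _] := kapP 0%N; rewrite -Ak inE.
have memA t : t \in equality_seq S xs -> inr t \in A -> t \in s'.
  move=> tE tA; apply/negPn/negP => ts; have /negP := mukA _ tA; apply.
  by have [_ _ _ _ [supp _]] := P (kap 0%N); rewrite supp.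
have app0 : signed_multiplier S xs (mu_ (kap 0%N)) by have [[]] := P (kap 0%N).
have I4sub : I4 \subset activeg S xs.
  apply/fintype.subsetP => i; rewrite inE => /mukA; apply: contraR => iI.
  by case: app0 => _ /(_ i iI) ->.
have AG i : inr (inr (inl i)) \in A -> i \in (I2 :|: I5)%SET.
  move=> iA; rewrite finset.in_setU.
  have : i \in (idxI S xs :|: idxJ S xs)%SET.
    apply/negPn/negP => iIJ; have /negP := mukA _ iA; apply.
    by case: app0 => _ _ /(_ i iIJ) ->.
  rewrite finset.in_setU => /orP[iI|iJ].
    by apply/orP; left; rewrite inE memA// mem_smooth_seq.
  by apply/orP; right; rewrite inE iJ iA.
have AH i : inr (inr (inr i)) \in A -> i \in (I3 :|: I6)%SET.
  move=> iA; rewrite finset.in_setU.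
  have : i \in (idxK S xs :|: idxJ S xs)%SET.
    apply/negPn/negP => iIJ; have /negP := mukA _ iA; apply.
    by case: app0 => _ _ _ /(_ i iIJ) ->.
  rewrite finset.in_setU => /orP[iI|iJ].
    by apply/orP; left; rewrite inE memA// mem_smooth_seq.
  by apply/orP; right; rewrite inE iJ iA.
have Ah i : inr (inl i) \in A -> i \in I1.
  by move=> iA; rewrite inE memA// mem_smooth_seq inE.
have s'mem t : t \in s' -> match t with
    | inl i => true | inr (inl i) => i \in idxI S xs
    | inr (inr i) => i \in idxK S xs end.
  by move=> /(mem_subseq ss); rewrite mem_smooth_seq; case: t => [i|[i|i]].
have I2sub : I2 \subset idxI S xs.
  by apply/fintype.subsetP => i; rewrite inE => /s'mem.
have I3sub : I3 \subset idxK S xs.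
  by apply/fintype.subsetP => i; rewrite inE => /s'mem.
have I5sub : I5 \subset idxJ S xs.
  by apply/fintype.subsetP => i; rewrite inE => /andP[].
have I6sub : I6 \subset idxJ S xs.
  by apply/fintype.subsetP => i; rewrite inE => /andP[].
have perm_s' : perm_eq (smooth_seq I1 I2 I3) s'.
  apply: uniq_perm => //; first exact: uniq_smooth_seq.
  by move=> t; rewrite mem_smooth_seq; case: t => [i|[i|i]]; rewrite inE.
have basis : basis_of <<smooth_family S [set: 'I_m]%SET (idxI S xs) (idxK S xs) xs>>
    (smooth_family S I1 I2 I3 xs).
  rewrite !smooth_familyE /basis_of.
  have pm := perm_map (smooth_grad S xs) perm_s'.
  by rewrite (perm_free pm) (eq_span (perm_mem pm)) es fs eqxx.
have h4 i : i \notin I4 -> mu (inl i) = 0.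
  by move=> iI; apply: muA; apply: contra iI; rewrite inE.
have h1 i : i \notin I1 -> mu (inr (inl i)) = 0.
  by move=> iI; apply: muA; apply: contra iI => /Ah.
have h2 i : i \notin (I2 :|: I5)%SET -> mu (inr (inr (inl i))) = 0.
  by move=> iI; apply: muA; apply: contra iI => /AG.
have h3 i : i \notin (I3 :|: I6)%SET -> mu (inr (inr (inr i))) = 0.
  by move=> iI; apply: muA; apply: contra iI => /AH.
have mult : RCPLD_multiplier S xs I1 I2 I3 I4 I5 I6 v
    (\row_i mu (inl i)) (\row_i mu (inr (inl i)))
    (\row_i - mu (inr (inr (inl i)))) (\row_i - mu (inr (inr (inr i)))) eta.
  split=> //.
  - move=> [/rowP z1 /rowP z2 /rowP z3 /rowP z4 _].
    move: sum1; rewrite big1 ?ler10// => -[i|[i|[i|i]]] _; apply/eqP; rewrite normr_eq0.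
    + by have := z1 i; rewrite !mxE => ->.
    + by have := z2 i; rewrite !mxE => ->.
    + by have := z3 i; rewrite !mxE => /eqP; rewrite oppr_eq0.
    + by have := z4 i; rewrite !mxE => /eqP; rewrite oppr_eq0.
  - split=> i iI; rewrite mxE.
    + exact: h4.
    + exact: h1.
    + by rewrite h2// oppr0.
    + by rewrite h3// oppr0.
  - split=> [i _|i iJ]; first by rewrite mxE.
    exact: signed_multiplier_M_sign sgn iJ.
  - by rewrite -[LHS]sum0 s0 scale0r add0r (multiplier_sum _ _ h4 h1 h2 h3).
have gvI i : i \in I4 -> limiting_subdifferential (sys_g S i) xs (v i) by [].
have := hRC _ _ _ I2sub I3sub basis _ _ _ I4sub I5sub I6sub _ _ _ _ _ _ gvI mult
  (x_ \o kap) (v_ \o kap) (eta_ \o kap).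
case=> //.
- by apply: cvg_inv_succ => j; have [] := kapP j.
- by move=> j; have [_ _ _ xj _] := P (kap j).
- move=> i _; split=> [j|]; first by have [[_ [_ gj] _ _ _] _ _ _ _] := P (kap j).
  by apply: cvg_inv_succ => j; have [_ _ _ vj] := kapP j; exact: vj.
- by apply: cvg_inv_succ => j; have [] := kapP j.
- move=> j i; apply: limiting_normal_cone_block.
  by have [[_ _ Nj _ _] _ _ _ _] := P (kap j).
(* RCPLD announces dependence for large indices, yet the family is independent at every [kap j], its
   indices lying in the support of the reduced multipliers; one index suffices. *)
move=> j _ /(_ j (leqnn j)).
have [_ _ _ _ [_ li]] := P (kap j); have [Aj _ _ _] := kapP j.
set X := (_ ++ _); suff -> : free X by [].
pose sq : seq (fam_index n m p l) := [seq inl (inl i) | i <- enum I4] ++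
  [seq inl (inr t) | t <- smooth_seq I1 (I2 :|: I5)%SET (I3 :|: I6)%SET] ++
  [seq inr i | i <- enum (nonzero_blocks (eta_ (kap j)))].
have -> : X = map (fam_vec S (v_ (kap j)) (x_ (kap j)) (eta_ (kap j))) sq.
  by rewrite /X smooth_familyE /sq !map_cat -!map_comp.
have usq : uniq sq.
  rewrite /sq !cat_uniq !map_inj_uniq ?enum_uniq ?uniq_smooth_seq//=; try by move=> a b [].
  rewrite andbT; apply/andP; split; apply/hasPn => t.
    by rewrite mem_cat => /orP[] /mapP[i _ ->]; apply/mapP => -[].
  by move=> /mapP[i _ ->]; apply/mapP => -[].
apply/(free_mapP _ usq); apply: lin_indep_sub li.
have mukj t : t \in A -> mu_ (kap j) t != 0 by rewrite -Aj inE.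
have inr_s' t : t \in s' -> inl (inr t) \in
    fam_support s' (mu_ (kap j)) (eta_ (kap j)).
  by move=> ts; rewrite inE; apply/orP; left; rewrite inE; apply: map_f.
have inl_A t : t \in A -> inl t \in fam_support s' (mu_ (kap j)) (eta_ (kap j)).
  by move=> tA; rewrite inE; apply/orP; right; rewrite inE; exact: mukj.
apply/fintype.subsetP => t; rewrite inE !mem_cat => /or3P[] /mapP[i + ->].
- by rewrite mem_enum inE; exact: inl_A.
- rewrite mem_smooth_seq; case: i => [i|[i|i]].
  + by rewrite inE; exact: inr_s'.
  + rewrite finset.in_setU => /orP[]; rewrite inE; first exact: inr_s'.
    by move=> /andP[_]; exact: inl_A.
  + rewrite finset.in_setU => /orP[]; rewrite inE; first exact: inr_s'.
    by move=> /andP[_]; exact: inl_A.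
- rewrite mem_enum inE => bi; rewrite inE; apply/orP; right; rewrite inE.
  exact: bi.
Qed.

(** The two cases are exact negations of each other: either some bound [M] works for every
    tolerance, or each [M] has a tolerance below which it is exceeded. *)
Lemma RCPLD_M_stationary : M_stationary S f xs.
Proof.
apply: contrapT => nM; apply: unbounded_multipliers_absurd => M.
apply: contrapT => HM; apply: nM; apply: (@bounded_multipliers_M_stationary M) => e e0.
apply: contrapT => He; apply: HM; exists e => // x zeta v mu eta app.
apply: contrapT => Ht; apply: He; exists x, zeta, v, mu, eta; split=> // t.
by rewrite leNgt; apply/negP => tM; apply: Ht; exists t.
Qed.

End Multipliers.

Theorem theorem3p1 (R : realType) (n m p l : nat) (q : 'I_l -> nat)
  (S : csystem R n m p q)
  (f : 'rV[R]_(\sum_i q i) -> R) (xs : 'rV[R]_(\sum_i q i))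
  (hS : standing_assumptions S xs)
  (hf : lipschitz_around f xs)
  (hmin : local_minimizer f (feasible S) xs)
  (hRCPLD : RCPLD S xs) :
  M_stationary S f xs.
Proof. exact: RCPLD_M_stationary. Qed.
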